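(* Let $\mathcal{I}=\{X; f_{ij}, p_{ij}: 1\leq i,j\leq N\}$ be a bi-Lipschitz recurrent iterated function system satisfying the strong open set condition, with $$c_{ij}d(x,y)\leq d(f_{ij}(x),f_{ij}(y))\leq s_{ij}d(x,y)\quad\text{for all } x,y\in X,$$ where $0<c_{ij}\leq s_{ij}<1$ for $1\leq i,j\leq N$. Let $\mu$ be the associated Borel probability measure supported on the limit set $E$ of $\mathcal{I}$, and let $r\in(0,\infty)$. Then $$l_r\leq\underline{D}_r(\mu)\leq \overline{D}_r(\mu)\leq k_r,$$ where $l_r,k_r\in(0,\infty)$ are uniquely given by $\phi_{r}\Big(\frac{l_r}{r+l_r}\Big)=1$ and $\Phi_{r}\Big(\frac{k_r}{r+k_r}\Big)=1$, respectively.
   Context: Recurrent IFS. Let $X\subset\mathbb{R}^k$ be a nonempty compact set equal to the closure of its interior, with Euclidean metric $d$. Let $N\geq 2$ and let $f_{ij}:X\to X$ ($1\le i,j\le N$) satisfy $c_{ij}d(x,y)\leq d(f_{ij}(x),f_{ij}(y))\leq s_{ij}d(x,y)$ for all $x,y\in X$, where $0<c_{ij}\leq s_{ij}<1$. Let $P=[p_{ij}]_{1\le i,j\le N}$ be an irreducible row stochastic matrix ($p_{ij}\ge 0$, $\sum_{j}p_{ij}=1$ for all $i$). The collection $\mathcal{I}=\{X;f_{ij},p_{ij}:1\le i,j\le N\}$ is called a bi-Lipschitz recurrent iterated function system (RIFS). There are unique nonempty compact sets $E_1,\dots,E_N\subseteq X$ with $E_i=\bigcup_{j:\,p_{ji}>0}f_{ij}(E_j)$;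 the limit set is $E=\bigcup_{i=1}^N E_i$. Measure. The code space is $\Omega=\{(w_1,w_2,\ldots): 1\le w_i\le N,\ p_{w_{i+1}w_i}>0 \text{ for all } i\in\mathbb{N}\}$. Let $p=(p_1,\dots,p_N)$ be the unique probability vector with $pP=p$. Let $\nu$ be the unique Borel probability measure on $\Omega$ with $\nu([w_1,\dots,w_n])=p_{w_2w_1}p_{w_3w_2}\cdots p_{w_nw_{n-1}}p_{w_n}$ for every cylinder $[w_1,\dots,w_n]=\{\tau\in\Omega:\tau_i=w_i,\ 1\le i\le n\}$. The coding map $\pi:\Omega\to E$ sends $w$ to the unique point of $\bigcap_{n\ge2}f_{w_1w_2}\circ f_{w_2w_3}\circ\cdots\circ f_{w_{n-1}w_n}(E_{w_n})$. The measure associated with $\mathcal{I}$ is $\mu=\nu\circ\pi^{-1}$ (its support is $E$). Strong open set condition (SOSC): there exist nonempty bounded open sets $U_1,\dots,U_N$ (contained in $X$, so that $f_{ij}(U_j)$ makes sense) such that $f_{ij}(U_j)\cap f_{kl}(U_l)=\emptyset$ for $(i,j)\neq(k,l)$, $f_{ij}(U_j)\subseteq U_i$, and $E_i\cap U_i\neq\emptyset$, for all $1\le i,j,k,l\le N$. Spectral radii. For $r\in(0,\infty)$ and $t\in[0,\infty)$, $\Phi_r(t)$ is the spectral radius of the $N\times N$ matrix $M_{r,t}=[(p_{ji}s_{ij}^r)^t]_{1\le i,j\le N}$, and $\phi_r(t)$ is the spectral radius of $L_{r,t}=[(p_{ji}c_{ij}^r)^t]_{1\le i,j\le N}$ (with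 the convention $0^0=1$). Quantization. For a Borel probability measure $\mu$ on $\mathbb{R}^k$, $r\in(0,\infty)$ and $n\in\mathbb{N}=\{1,2,\dots\}$, $V_{n,r}(\mu)=\inf\{\int \rho(x,A)^r\,d\mu(x): A\subset\mathbb{R}^k \text{ nonempty},\ \mathrm{card}(A)\le n\}$, where $\rho(x,A)$ is the Euclidean distance from $x$ to $A$, and $e_{n,r}(\mu)=V_{n,r}(\mu)^{1/r}$. The lower and upper quantization dimensions of order $r$, $\underline{D}_r(\mu)$ and $\overline{D}_r(\mu)$, are the limit inferior and limit superior as $n\to\infty$ of $\dfrac{\log n}{-\log e_{n,r}(\mu)}$.
   Formalization: Existence and uniqueness of l_r, k_r in (0,∞) is asserted only when P is not a permutation matrix; for a permutation matrix both spectral radii are below 1 for all t>0, so no such l_r, k_r exist. The inequalities are stated for all l_r, k_r > 0 that solve the equations. *)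

(* Defs.v *)
From HB Require Import structures.
From mathcomp Require Import all_boot all_order all_algebra.
From mathcomp Require Import perm complex.
From mathcomp Require Import all_classical all_reals all_analysis.

Set Implicit Arguments.
Unset Strict Implicit.
Unset Printing Implicit Defensive.

Import Order.TTheory GRing.Theory Num.Theory.
Import numFieldNormedType.Exports.

Local Open Scope classical_set_scope.
Local Open Scope ring_scope.

(* The norm that the library puts on 'rV[R]_k is the sup norm, so the Euclidean
   metric is defined here. Both induce the same topology: open, closed, compact
   and bounded sets below are those of the library. *)
Definition eucl_dist (R : realType) (k : nat) (x y : 'rV[R]_k) : R :=
  Num.sqrt (\sum_(i < k) (x 0 i - y 0 i) ^+ 2).

Definition eucl_dist_set (R : realType) (k : nat) (x : 'rV[R]_k)
    (A : set 'rV[R]_k) : R :=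
  inf [set eucl_dist x a | a in A].

Definition borel (T : ptopologicalType) := g_sigma_algebraType (@open T).

Definition stochastic (R : realType) (n : nat) (P : 'M[R]_n) : Prop :=
  (forall i j, 0 <= P i j) /\ (forall i, \sum_j P i j = 1).

Definition irreducible_mx (R : realType) (n : nat) (P : 'M[R]_n) : Prop :=
  forall i j, exists2 m : nat, (0 < m)%N & 0 < (P ^+ m) i j.

(* Eigenvalues are taken in the complex numbers R[i]; the set is finite and,
   for n > 0, nonempty, so that its supremum is a maximum. *)
Definition spectral_radius (R : realType) (n : nat) (A : 'M[R]_n) : R :=
  sup [set ComplexField.Normc.normc z |
        z in [set z : R[i] | eigenvalue (map_mx (real_complex R) A) z]].

(* The indices 1, ..., N are the elements of 'I_N with N = n.+2, so that N >= 2.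
   The maps are total functions, of which only the restrictions to the space X
   matter. *)
Record bilipschitz_rifs (R : realType) (k n : nat) := BilipschitzRIFS {
  rifs_space : set 'rV[R]_k ;
  rifs_map : 'I_n.+2 -> 'I_n.+2 -> 'rV[R]_k -> 'rV[R]_k ;
  rifs_mx : 'M[R]_n.+2 ;
  lower_lip : 'I_n.+2 -> 'I_n.+2 -> R ;
  upper_lip : 'I_n.+2 -> 'I_n.+2 -> R ;
  rifs_space_neq0 : rifs_space !=set0 ;
  rifs_space_compact : compact rifs_space ;
  rifs_space_regular : closure (interior rifs_space) = rifs_space ;
  rifs_map_space : forall i j x, rifs_space x -> rifs_space (rifs_map i j x) ;
  lip_bounds : forall i j,
    [/\ 0 < lower_lip i j, lower_lip i j <= upper_lip i j & upper_lip i j < 1] ;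
  rifs_map_bilipschitz : forall i j x y, rifs_space x -> rifs_space y ->
    lower_lip i j * eucl_dist x y <= eucl_dist (rifs_map i j x) (rifs_map i j y) /\
    eucl_dist (rifs_map i j x) (rifs_map i j y) <= upper_lip i j * eucl_dist x y ;
  rifs_mx_stochastic : stochastic rifs_mx ;
  rifs_mx_irreducible : irreducible_mx rifs_mx }.

HB.instance Definition _ (n : nat) := isPointed.Build 'I_n.+1 ord0.

(* All infinite words w_1 w_2 ... over the indices, with the product of the
   discrete topologies; the letter w_(i+1) is w i. *)
Definition words (n : nat) : Type := nat -> 'I_n.+2.

HB.instance Definition _ (n : nat) := Pointed.on (words n).
HB.instance Definition _ (n : nat) :=
  Topological.copy (words n) {ptws nat -> discrete_topology 'I_n.+2}.

Section RIFS.
Variables (R : realType) (k n : nat) (I : bilipschitz_rifs R k n).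

Local Notation N := n.+2.
Local Notation f := (rifs_map I).
Local Notation P := (rifs_mx I).

(* Note the transposed indices: f_ij is used when p_ji > 0. *)
Definition limit_sets (E : 'I_N -> set 'rV[R]_k) : Prop :=
  forall i, [/\ E i !=set0, compact (E i), E i `<=` rifs_space I &
    E i = \bigcup_(j in [set j | 0 < P j i]) (f i j @` E j)].

Definition strong_open_set_condition (E : 'I_N -> set 'rV[R]_k) : Prop :=
  exists U : 'I_N -> set 'rV[R]_k,
    [/\ forall i, [/\ U i !=set0, bounded_set (U i), open (U i) &
                      U i `<=` rifs_space I],
        forall i j i' j', (i, j) <> (i', j') ->
          (f i j @` U j) `&` (f i' j' @` U j') = set0,
        forall i j, f i j @` U j `<=` U i &
        forall i, E i `&` U i !=set0].

Definition stationary (p : 'rV[R]_N) : Prop :=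
  [/\ forall i, 0 <= p 0 i, \sum_i p 0 i = 1 & p *m P = p].

Definition code_space : set (words n) :=
  [set w | forall i : nat, 0 < P (w i.+1) (w i)].

(* The cylinder of the word w 0, ..., w m, which has m + 1 letters. *)
Definition cylinder (w : words n) (m : nat) : set (words n) :=
  [set t | code_space t /\ forall i, (i <= m)%N -> t i = w i].

(* A Borel probability measure on the code space is given as one on all words
   that is carried by the code space. *)
Definition code_measure (p : 'rV[R]_N) (nu : probability (borel (words n)) R) :
    Prop :=
  nu code_space = 1%E /\
  forall (w : words n) (m : nat),
    nu (cylinder w m) = ((\prod_(i < m) P (w i.+1) (w i)) * p 0 (w m))%:E.

(* The composite f_(w 0, w 1) o ... o f_(w (m - 1), w m) of m maps, which
   corresponds to the prefix of m + 1 letters. *)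
Fixpoint word_map (w : words n) (m : nat) : 'rV[R]_k -> 'rV[R]_k :=
  if m is m'.+1 then word_map w m' \o f (w m') (w m'.+1) else id.

Definition coding_map (E : 'I_N -> set 'rV[R]_k)
    (coding : words n -> 'rV[R]_k) : Prop :=
  forall w, code_space w ->
    \bigcap_(m in [set m | (1 <= m)%N]) (word_map w m @` E (w m)) =
      [set coding w].

Definition associated_measure (E : 'I_N -> set 'rV[R]_k)
    (mu : probability (borel 'rV[R]_k) R) : Prop :=
  exists (p : 'rV[R]_N) (nu : probability (borel (words n)) R)
         (coding : words n -> 'rV[R]_k),
    [/\ stationary p, code_measure p nu, coding_map E coding &
        forall B : set (borel 'rV[R]_k), measurable B ->
          mu B = nu (code_space `&` coding @^-1` B)].

(* [powR] satisfies 0 `^ 0 = 1. *)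
Definition upper_radius (r t : R) : R :=
  spectral_radius (\matrix_(i < N, j < N) (P j i * upper_lip I i j `^ r) `^ t).

Definition lower_radius (r t : R) : R :=
  spectral_radius (\matrix_(i < N, j < N) (P j i * lower_lip I i j `^ r) `^ t).

End RIFS.

Section Quantization.
Variables (R : realType) (k : nat) (mu : probability (borel 'rV[R]_k) R).
Local Open Scope ereal_scope.

Definition quantization_V (m : nat) (r : R) : \bar R :=
  ereal_inf [set \int[mu]_x (eucl_dist_set x A `^ r)%:E |
              A in [set A : set 'rV[R]_k | A !=set0 /\ (A #<= `I_m)%card]].

Definition quantization_error (m : nat) (r : R) : \bar R :=
  quantization_V m r `^ r^-1.

(* The term of index 0 is irrelevant to the limits below. *)
Definition quantization_ratio (r : R) (m : nat) : \bar R :=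
  lne m%:R%:E / - lne (quantization_error m r).

Definition lower_quantization_dim (r : R) : \bar R :=
  limn_einf (quantization_ratio r).

Definition upper_quantization_dim (r : R) : \bar R :=
  limn_esup (quantization_ratio r).

End Quantization.

(* Main.v *)
Require Import Defs.
From mathcomp Require Import all_boot all_order all_algebra.
From mathcomp Require Import perm complex.
From mathcomp Require Import all_classical all_reals all_analysis.
From mathcomp Require Import measurable_realfun.
From mathcomp Require Import ring lra.

(** For a word [w = w_1 ... w_m] let [p_w], [c_w] and [s_w] be the products along
    [w] of the transition probabilities and of the lower and upper Lipschitz
    constants. The codes that begin with [w] have measure comparable to [p_w] and
    are mapped into a piece of the limit set of diameter at most a constant times
    [s_w], so that replacing the piece by one of its points costs at most a
    constant times [p_w s_w^r]. Both dimension bounds come from cutting the tree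
    of words where such a weight passes a threshold [e].

    Upper bound. At [t = u / (r + u)] the matrix of the [(p_ji s_ij^r)^t] is
    irreducible with spectral radius 1, hence has a positive eigenvector [v] for
    the eigenvalue 1 ([perron_frobenius]). So the sum of
    [(p_w s_w^r)^t * v_(w_m)] over the words at which the tree is cut does not
    depend on the cut. Cutting where [p_w s_w^r] first drops below [e] leaves at
    most a constant times [e^-t] pieces, each of cost at most a constant times
    [e] ([covering_words], [quantization_V_le]). With [m] points one takes [e]
    of order [m^(-1/t)], and the error is at most [C m^(1 - 1/t) = C m^(-r/u)].

    Lower bound. For [l' < l] the spectral radius of the matrix of the
    [(p_ji c_ij^r)^t'] at [t' = l' / (r + l')] exceeds 1. By the strong open set
    condition every letter [j] has a word [tau_j] whose piece lies inside [U_j].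
    Take all words of a fixed length [q] and append to each one the word [tau]
    of its last letter: the resulting pieces are compact and pairwise disjoint,
    so they are a positive distance [delta] apart, and for [q] large the growth
    of the [q]-th power of the matrix outweighs the fixed price of the [tau_j]
    ([separated_subsystem]). Cutting the tree of this strongly separated
    subsystem at [e] gives at least a constant times [e^-t'] pieces; the piece
    of [w] carries mass at least a constant times [p_w], where [p_w c_w^r] is at
    least a constant times [e], and it is at distance at least [delta * c_w]
    from the others ([separated_words]). A set of half as many points leaves at
    least half of the pieces without a point nearby, and each of these
    contributes at least a constant times [e] to the error
    ([quantization_V_ge]). This gives an error of at least [C m^(-r/l')].

    Existence and uniqueness of the exponents. If [0 < m <= g <= k < 1] for all
    positive entries [g] of the weight matrix, then adding [h] to the exponent
    multiplies the spectral radius by a factor between [m^h] and [k^h]: it is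
    strictly decreasing and has no jumps. It is less than 1 at the exponent 1,
    where the column sums are less than 1. As the exponent tends to 0 it tends
    to the spectral radius of the 0-1 matrix of the graph of transitions, which
    exceeds 1 unless the graph is a cycle, that is, unless the stochastic matrix
    is a permutation matrix ([radius_gt1_near0],
    [row_with_two_positive_entries]). *)

Set Implicit Arguments.
Unset Strict Implicit.
Unset Printing Implicit Defensive.

Import Order.TTheory GRing.Theory Num.Theory.
Import numFieldNormedType.Exports.

Local Open Scope classical_set_scope.
Local Open Scope ring_scope.

(** * The Perron-Frobenius theorem *)

Section Perron.
Variable R : realType.

Lemma finite_positive_lower_bound (T : finType) (P : pred T) (g : T -> R) :
  (forall i, P i -> 0 < g i) ->
  exists e : R, [/\ 0 < e, e <= 1 & forall i, P i -> e <= g i].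
Proof.
move=> gP; exists (\big[Order.min/1]_(i | P i) g i); split.
- by apply: lt_bigmin.
- exact: bigmin_le_id.
- by move=> i Pi; apply: bigmin_le_cond.
Qed.

Section IrreducibleMatrix.
Variables (n : nat) (A : 'M[R]_n.+1).
Hypothesis A_ge0 : forall i j, 0 <= A i j.
Hypothesis A_irr : irreducible_mx A.

Lemma nonneg_mx_exp m i j : 0 <= (A ^+ m) i j.
Proof.
elim: m i j => [|m IH] i j; first by rewrite expr0 mxE ler0n.
by rewrite exprS mxE sumr_ge0 // => l _; rewrite mulr_ge0.
Qed.

(** The sum of sufficiently many powers of [A]. It turns nonzero nonnegative
    vectors into positive ones and respects inequalities between [x A] and
    multiples of [x]. *)
Lemma exists_positive_commuting_mx :
  exists2 B : 'M[R]_n.+1, A *m B = B *m A & forall i j, 0 < B i j.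
Proof.
have /choice [m mP] : forall ij : 'I_n.+1 * 'I_n.+1, exists m,
    0 < (A ^+ m) ij.1 ij.2.
  by move=> [i j]; have [m _ ?] := A_irr i j; exists m.
pose M := \max_ij m ij.
exists (\sum_(l < M.+1) A ^+ l).
  rewrite -![_ *m _]/(_ * _) mulr_sumr mulr_suml; apply: eq_bigr => l _.
  by rewrite -exprS -exprSr.
move=> i j; rewrite summxE.
have lM : (m (i, j) < M.+1)%N by rewrite ltnS; exact: leq_bigmax.
rewrite (bigD1 (Ordinal lM)) //=. apply: ltr_pwDl; first exact: (mP (i, j)). 
by apply: sumr_ge0 => l _; exact: nonneg_mx_exp.
Qed.

(** Take the largest [lam] for which some positive [x], normalized to lie in a
    compact box, satisfies [lam x <= x A]. If the defect [d = x A - lam x] were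
    not zero then the positive matrix [B] would make it positive in every
    coordinate, and [x B] would admit a larger [lam]. Restricting to a box away
    from the coordinate hyperplanes loses nothing, since after multiplication by
    [B] all vectors are in the box, up to scaling; this is how the bound [eta]
    is chosen. *)
Lemma perron_left_eigenvector :
  exists (lam : R) (v : 'rV[R]_n.+1),
    [/\ 0 <= lam, forall i, 0 < v 0 i & v *m A = lam *: v].
Proof.
have [B AB B_gt0] := exists_positive_commuting_mx.
have [b [b0 _ bB]] := @finite_positive_lower_bound _ predT
  (fun ij : 'I_n.+1 * 'I_n.+1 => B ij.1 ij.2) (fun ij _ => B_gt0 ij.1 ij.2).
pose b' : R := \sum_i \sum_j B i j.
have Bb' i j : B i j <= b'.
  rewrite /b' (bigD1 i) //= (bigD1 j) //= -addrA ler_wpDr // addr_ge0 //.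
    by apply: sumr_ge0 => l _; exact: ltW.
  by apply: sumr_ge0 => l _; apply: sumr_ge0 => ? _; exact: ltW.
have b'0 : 0 < b' by apply: lt_le_trans (Bb' ord0 ord0).
pose eta := b / b'.
have eta0 : 0 < eta by rewrite divr_gt0.
have eta1 : eta <= 1.
  rewrite ler_pdivrMr // mul1r (le_trans _ (Bb' ord0 ord0)) //.
  exact: (bB (ord0, ord0)).
pose K := [set x : 'rV[R]_n.+1 | forall i, `[eta, 1]%classic (x ord0 i)].
have K_compact : compact K.
  apply: (@rV_compact R _ (fun=> `[eta, 1]%classic)) => i.
  exact: segment_compact.
(* Any [lam] admissible for some vector of the box is at most [C]: compare the
   first coordinates. *)
pose C : R := (\sum_j A j ord0) / eta.
have C_ge0 : 0 <= C by rewrite divr_ge0 ?sumr_ge0 // ltW.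
pose feas i := [set z : 'rV[R]_n.+1 * R | 0 <= (z.1 *m A) 0 i - z.2 * z.1 0 i].
pose T := (K `*` `[0, C]%classic) `&` \bigcap_i feas i.
have T_compact : compact T.
  apply: compact_closedI.
    by apply: compact_setX => //; exact: segment_compact.
  apply: closed_bigI => i _.
  pose g (z : 'rV[R]_n.+1 * R) := (z.1 *m A) 0 i - z.2 * z.1 0 i.
  have cg : continuous g.
    move=> z.
    have cc j : (fun z : 'rV[R]_n.+1 * R => z.1 0 j) @ z --> z.1 0 j.
      apply: (@cvg_comp _ _ _ fst (fun x : 'rV[R]_n.+1 => x 0 j)).
        exact: cvg_fst.
      exact: coord_continuous.
    apply: cvgB; last first.
      by apply: cvgM; [exact: cvg_snd | exact: cc].
    under eq_fun do rewrite mxE.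
    rewrite mxE; apply: cvg_big => [|j _]; first exact: add_continuous.
    by apply: cvgM; [exact: cc | exact: cvg_cst].
  have -> : feas i = g @^-1` [set y | 0 <= y] by [].
  by apply: closed_comp => //; exact: closed_ge.
have T_neq0 : T !=set0.
  exists (const_mx 1, 0); split.
    split; rewrite /= ?in_itv /= ?lexx //.
    by move=> i; rewrite /= mxE in_itv /= eta1 lexx.
  move=> i _; rewrite /feas /= mul0r subr0 mxE sumr_ge0 // => j _.
  by rewrite mxE mul1r.
have [] := @compact_EVT_max _ R snd T T_neq0 T_compact.
  by apply: continuous_subspaceT => z; exact: cvg_snd.
move=> [x lam]; rewrite inE => -[[/= xK lamC] xf] lam_max.
have x0 i : 0 < x 0 i.
  by have := xK i; rewrite /= in_itv /= => /andP[+ _]; exact: lt_le_trans.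
move: lamC; rewrite in_itv /= => /andP[lam0 lamC].
exists lam, x; split => //.
pose d := x *m A - lam *: x.
suff d0 : d = 0 by apply/eqP; rewrite -subr_eq0 -/d d0.
apply/eqP/negPn/negP => dn0.
have d_ge0 i : 0 <= d 0 i.
  suff -> : d 0 i = (x *m A) 0 i - lam * x 0 i by exact: (xf i).
  by rewrite !mxE.
have [i0 di0] : exists i, 0 < d 0 i.
  case/rV0Pn: dn0 => i di; exists i.
  by rewrite lt_neqAle eq_sym di /=.
have dB0 i : 0 < (d *m B) 0 i.
  rewrite mxE (bigD1 i0) //= ltr_pwDl ?mulr_gt0 //.
  by apply: sumr_ge0 => l _; rewrite mulr_ge0 // ltW.
pose c := b' * \sum_j x 0 j.
have sx0 : 0 < \sum_j x 0 j.
  rewrite (bigD1 ord0) //= ltr_pwDl //.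
  by apply: sumr_ge0 => l _; exact: ltW.
have c0 : 0 < c by rewrite mulr_gt0.
pose y := c^-1 *: (x *m B).
have yK : K y.
  move=> i; rewrite /= in_itv /= !mxE mulrC ler_pdivlMr // ler_pdivrMr // mul1r.
  apply/andP; split.
    rewrite /eta /c mulrA mulfVK ?gt_eqF // mulr_sumr ler_sum // => j _.
    by rewrite mulrC ler_wpM2l ?(bB (j, i)) // ltW.
  rewrite /c mulr_sumr ler_sum // => j _.
  by rewrite mulrC ler_wpM2r // ltW.
have [e [e0 _ eP]] := @finite_positive_lower_bound _ predT
  (fun i => (d *m B) 0 i / c) (fun i _ => divr_gt0 (dB0 i) c0).
have yfeas i : (lam + e) * y 0 i <= (y *m A) 0 i.
  have -> : y *m A = lam *: y + c^-1 *: (d *m B).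
    rewrite /y /d mulmxBl -!scalemxAl -mulmxA -AB mulmxA scalerBr.
    rewrite [lam *: _ in RHS]scalerA [c^-1 *: (lam *: _)]scalerA (mulrC lam).
    by rewrite addrC subrK.
  rewrite mulrDl [leRHS]mxE [(lam *: y) 0 i]mxE lerD2l.
  have := yK i; rewrite /= in_itv /= => /andP[y_ge y_le].
  apply: le_trans (_ : e <= _).
    by rewrite ler_piMr // ltW.
  by rewrite [leRHS]mxE mulrC; exact: eP.
have : lam + e <= lam; last by rewrite gerDl leNgt e0.
have -> : lam + e = (y, lam + e).2 by [].
apply: lam_max; rewrite inE; split; last first.
  by move=> i _; rewrite /feas /= subr_ge0.
split => //=; rewrite in_itv /= addr_ge0 ?(ltW e0) //=.
rewrite /C ler_pdivlMr //.
have := yK ord0; rewrite /= in_itv /= => /andP[y_ge _].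
apply: (@le_trans _ _ ((lam + e) * y 0 ord0)).
  by rewrite ler_wpM2l // addr_ge0 // ltW.
apply: le_trans (yfeas ord0) _; rewrite mxE ler_sum // => j _.
have := yK j; rewrite /= in_itv /= => /andP[_ y_le].
by rewrite ler_piMl.
Qed.

End IrreducibleMatrix.
End Perron.

Lemma normc_real (R : realType) (x : R) :
  ComplexField.Normc.normc (real_complex R x) = `|x|.
Proof. by rewrite /= expr0n /= addr0 sqrtr_sqr. Qed.

Lemma normc_ge0 (R : realType) (z : complex R) : 0 <= ComplexField.Normc.normc z.
Proof. by case: z => a b; exact: sqrtr_ge0. Qed.

Lemma normc_sum (R : realType) (I : finType) (F : I -> complex R) :
  ComplexField.Normc.normc (\sum_i F i) <=
  \sum_i ComplexField.Normc.normc (F i).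
Proof.
elim/big_rec2: _ => [|i x z _ IH]; first by rewrite ComplexField.Normc.normc0.
exact: le_trans (le_normcD _ _) (lerD (lexx _) IH).
Qed.

Lemma irreducible_trmx (R : realType) n (A : 'M[R]_n.+1) :
  irreducible_mx A -> irreducible_mx A^T.
Proof.
move=> irrA i j; have [m m0 Am] := irrA j i; exists m => //.
suff -> : A^T ^+ m = (A ^+ m)^T by rewrite mxE.
elim: m {m0 Am} => [|m IH]; first by rewrite !expr0 trmx1.
by rewrite exprS exprSr IH -[LHS]/(A^T *m (A ^+ m)^T) -trmx_mul.
Qed.

(** The eigenvalues of the left and right positive eigenvectors [v] and [w]
    agree because both are determined by the number [v A w]. They dominate the
    modulus of any complex eigenvalue [z]: if [y A = z y] then the vector [a] of
    the moduli of the [y_i] satisfies [|z| a <= a A]; pair this with [w]. *)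
Theorem perron_frobenius (R : realType) n (A : 'M[R]_n.+1) :
  (forall i j, 0 <= A i j) -> irreducible_mx A ->
  exists v w : 'I_n.+1 -> R,
    [/\ forall i, 0 < v i, forall i, 0 < w i,
        forall j, \sum_i v i * A i j = spectral_radius A * v j &
        forall i, \sum_j A i j * w j = spectral_radius A * w i].
Proof.
move=> A_ge0 irrA.
have [lam [v [lam0 v0 vA]]] := perron_left_eigenvector A_ge0 irrA.
have AT_ge0 i j : 0 <= A^T i j by rewrite mxE.
have [lam' [w [_ w0 wA]]] :=
  perron_left_eigenvector AT_ge0 (irreducible_trmx irrA).
have vE j : \sum_i v 0 i * A i j = lam * v 0 j.
  by have /rowP/(_ j) := vA; rewrite !mxE.
have wE i : \sum_j A i j * w 0 j = lam' * w 0 i.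
  have /rowP/(_ i) := wA; rewrite !mxE => <-; apply: eq_bigr => j _.
  by rewrite mxE mulrC.
have vw0 : 0 < \sum_i v 0 i * w 0 i.
  rewrite (bigD1 ord0) //= ltr_pwDl ?mulr_gt0 //.
  by apply: sumr_ge0 => l _; rewrite ltW // mulr_gt0.
have lamE : lam' = lam.
  apply: (mulIf (lt0r_neq0 vw0)); rewrite !mulr_sumr.
  transitivity (\sum_i v 0 i * \sum_j A i j * w 0 j).
    by apply: eq_bigr => i _; rewrite wE mulrCA.
  under eq_bigr do rewrite mulr_sumr.
  rewrite exchange_big /=; apply: eq_bigr => j _.
  by rewrite mulrA -vE mulr_suml; apply: eq_bigr => i _; rewrite mulrA.
subst lam'.
suff srE : spectral_radius A = lam.
  by exists (v 0), (w 0); rewrite srE.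
have v_neq0 : v != 0.
  by apply/rV0Pn; exists ord0; rewrite gt_eqF.
pose S := [set ComplexField.Normc.normc z |
  z in [set z | eigenvalue (map_mx (real_complex R) A) z]].
have S_lam : S lam.
  exists (real_complex R lam); last by rewrite normc_real ger0_norm.
  by rewrite /= eigenvalue_map; apply/eigenvalueP; exists v.
have S_ub : ubound S lam.
  move=> _ [z /= /eigenvalueP [y yA y0] <-].
  pose a i := ComplexField.Normc.normc (y 0 i).
  have aE j : ComplexField.Normc.normc z * a j <= \sum_i a i * A i j.
    rewrite -ComplexField.Normc.normcM.
    have /rowP/(_ j) := yA; rewrite !mxE => <-.
    apply: le_trans (normc_sum _) _; apply: ler_sum => i _.
    by rewrite ComplexField.Normc.normcM mxE normc_real ger0_norm.
  have aw0 : 0 < \sum_i a i * w 0 i.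
    case/rV0Pn: y0 => i yi.
    have ai0 : 0 < a i.
      rewrite lt_neqAle normc_ge0 andbT eq_sym.
      by apply: contra yi => /eqP/ComplexField.Normc.eq0_normc ->.
    rewrite (bigD1 i) //= ltr_pwDl ?mulr_gt0 //.
    by apply: sumr_ge0 => l _; rewrite mulr_ge0 ?normc_ge0 // ltW.
  rewrite -(ler_pM2r aw0) !mulr_sumr.
  apply: le_trans (_ : \sum_j (\sum_i a i * A i j) * w 0 j <= _).
    by apply: ler_sum => j _; rewrite mulrA ler_wpM2r // ltW.
  under eq_bigr do rewrite mulr_suml.
  rewrite exchange_big /=; apply: ler_sum => i _.
  rewrite mulrCA -wE mulr_sumr le_eqVlt; apply/orP; left; apply/eqP.
  by apply: eq_bigr => j _; rewrite mulrA.
apply/eqP; rewrite eq_le; apply/andP; split.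
  by apply: ge_sup => //; exists lam.
by apply: ub_le_sup => //; exists lam.
Qed.

Section RadiusComparison.
Variables (R : realType) (n : nat) (A : 'M[R]_n.+1).
Hypotheses (A_ge0 : forall i j, 0 <= A i j) (irrA : irreducible_mx A).

Lemma spectral_radius_ge0 : 0 <= spectral_radius A.
Proof.
have [v [w [v0 w0 vA wA]]] := perron_frobenius A_ge0 irrA.
rewrite -(pmulr_lge0 _ (v0 ord0)) -vA sumr_ge0 // => i _.
by rewrite mulr_ge0 // ltW.
Qed.

(* Pairing with the positive left eigenvector; the boolean selects the direction
   of both inequalities. *)
Let spectral_radius_cmp (x : 'I_n.+1 -> R) (c : R) (s : bool) :
  (forall i, 0 < x i) ->
  (forall i, if s then \sum_j A i j * x j <= c * x i
             else c * x i <= \sum_j A i j * x j) ->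
  if s then spectral_radius A <= c else c <= spectral_radius A.
Proof.
have [v [w [v0 w0 vA wA]]] := perron_frobenius A_ge0 irrA.
move=> x0 xA.
have vx0 : 0 < \sum_i v i * x i.
  rewrite (bigD1 ord0) //= ltr_pwDl ?mulr_gt0 //.
  by apply: sumr_ge0 => l _; rewrite ltW // mulr_gt0.
have vAx : \sum_i v i * \sum_j A i j * x j =
    spectral_radius A * \sum_i v i * x i.
  under eq_bigr do rewrite mulr_sumr.
  rewrite exchange_big mulr_sumr /=; apply: eq_bigr => j _.
  by rewrite mulrA -vA mulr_suml; apply: eq_bigr => i _; rewrite mulrA.
case: s xA => xA; rewrite -(ler_pM2r vx0) -vAx mulr_sumr ler_sum // => i _;
  by rewrite mulrCA ler_pM2l.
Qed.

(** Upper half of the Collatz-Wielandt characterization of the radius. *)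
Lemma spectral_radius_le (x : 'I_n.+1 -> R) (c : R) :
  (forall i, 0 < x i) -> (forall i, \sum_j A i j * x j <= c * x i) ->
  spectral_radius A <= c.
Proof. exact: (@spectral_radius_cmp x c true). Qed.

(** Lower half of the Collatz-Wielandt characterization of the radius. *)
Lemma spectral_radius_ge (x : 'I_n.+1 -> R) (c : R) :
  (forall i, 0 < x i) -> (forall i, c * x i <= \sum_j A i j * x j) ->
  c <= spectral_radius A.
Proof. exact: (@spectral_radius_cmp x c false). Qed.

End RadiusComparison.

Section Irreducible.
Variables (R : realType) (n : nat).
Implicit Types A B : 'M[R]_n.+1.

(** Irreducibility depends only on the graph of the positive entries. *)
Lemma irreducible_pattern A B : (forall i j, 0 <= A i j) ->
  (forall i j, 0 <= B i j) -> (forall i j, 0 < A i j -> 0 < B i j) ->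
  irreducible_mx A -> irreducible_mx B.
Proof.
move=> A0 B0 AB irrA i j; have [m m0 Am] := irrA i j; exists m => // {m0}.
elim: m i Am => [|m IH] i; first by rewrite !expr0 !mxE.
rewrite !exprS !mxE => Am.
have [l /andP[Al Aml]] : exists l, (0 < A i l) && (0 < (A ^+ m) l j).
  apply/existsP; apply: contraLR Am => /existsPn noA; rewrite -leNgt.
  apply: sumr_le0 => l _; have := noA l.
  rewrite negb_and -!leNgt => /orP[Al|Aml].
    by rewrite mulr_le0_ge0 // nonneg_mx_exp.
  by rewrite mulr_ge0_le0.
rewrite (bigD1 l) //= ltr_pwDl //; first by rewrite mulr_gt0 ?AB ?IH.
by apply: sumr_ge0 => h _; rewrite mulr_ge0 // nonneg_mx_exp.
Qed.

(** Irreducibility in the form of an induction principle along the edges of the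
    strongly connected graph of the positive entries. *)
Lemma irreducible_backward_closed A (Q : 'I_n.+1 -> Prop) :
  (forall i j, 0 <= A i j) -> irreducible_mx A ->
  (forall i j, 0 < A i j -> Q j -> Q i) -> forall i j, Q j -> Q i.
Proof.
move=> A0 irrA QA i j Qj; have [m _] := irrA i j.
elim: m i => [|m IH] i.
  by rewrite expr0 mxE; have [->//|_] := eqVneq i j; rewrite ltxx.
rewrite exprS mxE => Am; apply: contrapT => nQi.
suff : \sum_l A i l * (A ^+ m) l j <= 0 by rewrite leNgt Am.
apply: sumr_le0 => l _.
have [Al|Al] := ltP 0 (A i l); last by rewrite mulr_le0_ge0 // nonneg_mx_exp.
have [Aml|Aml] := ltP 0 ((A ^+ m) l j); last by rewrite mulr_ge0_le0.
by case: nQi; exact: QA Al (IH _ Aml).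
Qed.

Lemma irreducible_col_positive A j :
  (forall i j, 0 <= A i j) -> irreducible_mx A -> exists i, 0 < A i j.
Proof.
move=> A0 irrA; have [[//|m] _] := irrA j j.
rewrite exprSr mxE => Am; apply/existsP; apply: contraLR Am => /existsPn noA.
rewrite -leNgt sumr_le0 // => l _.
by rewrite mulr_ge0_le0 ?nonneg_mx_exp // leNgt noA.
Qed.

End Irreducible.

(** * Spectral radius of the entrywise powers of a matrix *)
Lemma powR_close_to_1 (R : realType) (m y : R) : 0 < m <= 1 -> y < 1 ->
  exists h, [/\ 0 < h, h < 1 & y < m `^ h].
Proof.
move=> /andP[m0 m1] y1.
have [y0|y0] := leP y 0.
  exists 2^-1; split; rewrite ?invr_gt0 ?ltr0n //; first lra.
  by apply: le_lt_trans y0 (powR_gt0 _ m0).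
have ly : 0 < - ln y by rewrite oppr_gt0 ln_lt0 // y0.
have lm : 0 <= - ln m by rewrite oppr_ge0 ln_le0.
pose a := Num.min (2^-1 : R) (- ln y).
have a0 : 0 < a by rewrite lt_min invr_gt0 ltr0n.
have a2 : a <= 2^-1 by rewrite ge_min lexx.
have ay : a <= - ln y by rewrite ge_min lexx orbT.
have b0 : 0 < 1 - ln m by lra.
exists (a / (1 - ln m)); split; first by rewrite divr_gt0.
  rewrite ltr_pdivrMr //; lra.
rewrite -ltr_ln ?posrE ?powR_gt0 // ln_powR mulrAC.
rewrite ltr_pdivlMr //.
have : 0 <= - ln m * (- ln y - a) by rewrite mulr_ge0 // subr_ge0.
nra.
Qed.

(** An intermediate value theorem for a function that cannot drop suddenly: the
    supremum [T] of the points with [1 <= f] has value 1. If [f T < 1], the growth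
    condition between a point [s] just below [T] and [T] forces [f s < 1];
    if [f T > 1], it gives a point beyond [T] with [1 <= f]. *)
Lemma slowly_decreasing_hits_1 (R : realType) (f : R -> R) (m a b : R) :
  0 < m <= 1 ->
  (forall t h, a <= t -> 0 <= h -> m `^ h * f t <= f (t + h)) ->
  1 < f a -> (forall t, b <= t -> f t < 1) ->
  exists t, [/\ a <= t, t < b & f t = 1].
Proof.
move=> m01 growth fa fb; have /andP[m0 m1] := m01.
pose S := [set t | a <= t /\ 1 <= f t].
have S_lt t : S t -> t < b.
  by move=> [_ ft]; rewrite ltNge; apply/negP => /fb; rewrite ltNge ft.
have S_sup : has_sup S.
  by split; [exists a; split => //; exact: ltW | exists b => t /S_lt/ltW].
have [T TS] : {T | T = sup S} by exists (sup S).
have S_le t : S t -> t <= T by rewrite TS; apply: ub_le_sup; case: S_sup.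
have aT : a <= T by apply: S_le; split => //; exact: ltW.
suff fT : f T = 1.
  by exists T; split => //; apply: S_lt; split => //; rewrite fT.
apply/eqP; case: (ltgtP (f T) 1) => // [fT|fT].
  have [h [h0 _ hm]] := powR_close_to_1 m01 fT.
  have [s [as_ fs]] := sup_adherent h0 S_sup; rewrite -TS => Ts.
  have sT : s <= T by exact: S_le.
  have Ts0 : 0 <= T - s by rewrite subr_ge0.
  have := growth s (T - s) as_ Ts0; rewrite (addrC s) subrK.
  suff : f T < m `^ (T - s) * f s by rewrite ltNge => /negbTE ->.
  apply: lt_le_trans hm _; apply: le_trans (_ : m `^ (T - s) <= _).
    by apply: ger_powR => //; rewrite lerBlDr -lerBlDl ltW.
  by rewrite ler_peMr // powR_ge0.
have fT0 : 0 < f T by exact: lt_trans fT.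
have fTV : (f T)^-1 < 1 by rewrite invf_lt1.
have [h [h0 _ hm]] := powR_close_to_1 m01 fTV.
have : S (T + h).
  split; first by rewrite (le_trans aT) // lerDl ltW.
  apply: le_trans (growth T h aT (ltW h0)).
  by rewrite -ler_pdivrMr // mul1r ltW.
by move/S_le; rewrite gerDl leNgt h0.
Qed.

Section PowerFamily.
Variables (R : realType) (n : nat) (G : 'M[R]_n.+1).
Hypotheses (G_ge0 : forall i j, 0 <= G i j) (G_lt1 : forall i j, G i j < 1).
Hypothesis irrG : irreducible_mx G.

Definition mx_powR (t : R) : 'M[R]_n.+1 := \matrix_(i, j) G i j `^ t.

Local Notation rho t := (spectral_radius (mx_powR t)).

Lemma mx_powR_ge0 t i j : 0 <= mx_powR t i j.
Proof. by rewrite mxE powR_ge0. Qed.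

Lemma mx_powR_irreducible t : irreducible_mx (mx_powR t).
Proof.
apply: irreducible_pattern irrG => // i j; first exact: mx_powR_ge0.
by rewrite mxE; exact: powR_gt0.
Qed.

Let perronG t := perron_frobenius (mx_powR_ge0 t) (mx_powR_irreducible t).

Lemma entry_upper_bound : exists k : R, [/\ 0 < k, k < 1 & forall i j, G i j <= k].
Proof.
have H : forall ij : 'I_n.+1 * 'I_n.+1, predT ij -> 0 < 1 - G ij.1 ij.2.
  by move=> ij _; rewrite subr_gt0.
have [e [e0 e1 eP]] := finite_positive_lower_bound H.
exists (1 - e / 2); split; [lra|lra|move=> i j].
by have := eP (i, j) isT => /=; lra.
Qed.

Lemma positive_entry_lower_bound :
  exists m : R, [/\ 0 < m, m <= 1 & forall i j, 0 < G i j -> m <= G i j].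
Proof.
have H : forall ij : 'I_n.+1 * 'I_n.+1, 0 < G ij.1 ij.2 -> 0 < G ij.1 ij.2 by [].
have [e [e0 e1 eP]] := finite_positive_lower_bound H.
by exists e; split => // i j; exact: (eP (i, j)).
Qed.

Lemma powR_entry_add t h i j : 0 < t -> 0 <= h ->
  G i j `^ (t + h) = G i j `^ h * G i j `^ t.
Proof.
by move=> t0 h0; rewrite addrC powRD // gt_eqF // ltr_wpDl.
Qed.

(** The positive eigenvector at [t] serves as a test vector at [t + h]. *)
Lemma radius_decay (k t h : R) : 0 < t -> 0 <= h ->
  (forall i j, G i j <= k) -> rho (t + h) <= k `^ h * rho t.
Proof.
move=> t0 h0 kG; have [v [w [v0 w0 vA wA]]] := perronG t.
apply: (spectral_radius_le (mx_powR_ge0 _) (mx_powR_irreducible _) w0) => i.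
rewrite -mulrA -wA mulr_sumr; apply: ler_sum => j _.
rewrite mulrA ler_pM2r // !mxE powR_entry_add // ler_wpM2r ?powR_ge0 //.
apply: ge0_ler_powR => //; rewrite nnegrE //.
exact: le_trans (kG i j).
Qed.

Lemma radius_growth (m t h : R) : 0 < t -> 0 <= h -> 0 < m ->
  (forall i j, 0 < G i j -> m <= G i j) -> m `^ h * rho t <= rho (t + h).
Proof.
move=> t0 h0 m0 mG; have [v [w [v0 w0 vA wA]]] := perronG t.
apply: (spectral_radius_ge (mx_powR_ge0 _) (mx_powR_irreducible _) w0) => i.
rewrite -mulrA -wA mulr_sumr; apply: ler_sum => j _.
rewrite mulrA ler_pM2r // !mxE powR_entry_add //.
have := G_ge0 i j; rewrite le_eqVlt => /predU1P[<-|Gij].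
  by rewrite [0 `^ t]powR0 ?gt_eqF // !mulr0.
rewrite ler_wpM2r ?powR_ge0 //.
by apply: ge0_ler_powR; rewrite ?nnegrE // ?mG // ltW.
Qed.

Lemma radius_strictly_decreasing t t' : 0 < t -> t < t' -> 0 < rho t ->
  rho t' < rho t.
Proof.
move=> t0 tt' rt0; have [k [k0 k1 kG]] := entry_upper_bound.
have -> : t' = t + (t' - t) by rewrite addrC subrK.
have h0 : 0 < t' - t by rewrite subr_gt0.
apply: le_lt_trans (radius_decay t0 (ltW h0) kG) _.
rewrite gtr_pMl // -[ltRHS](powRr0 k) /powR gt_eqF // ltr_expR ltr_nM2r //.
by rewrite ln_lt0 // k0.
Qed.

Lemma radius_root_unique t t' : 0 < t -> 0 < t' -> rho t = 1 -> rho t' = 1 ->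
  t = t'.
Proof.
move=> t0 t'0 r1 r'1; apply/eqP; case: (ltgtP t t') => // tt'.
  have := radius_strictly_decreasing t0 tt'.
  by rewrite r1 r'1 ltxx ltr01 => /(_ isT).
have := radius_strictly_decreasing t'0 tt'.
by rewrite r1 r'1 ltxx ltr01 => /(_ isT).
Qed.

(** Summing the eigenvector equation over all coordinates. *)
Lemma radius_lt1_col_sums (k : R) : k < 1 ->
  (forall j, \sum_i G i j <= k) -> rho 1 < 1.
Proof.
move=> k1 kG; have [v [w [v0 w0 vA wA]]] := perronG 1.
have sw0 : 0 < \sum_i w i.
  rewrite (bigD1 ord0) //= ltr_pwDl //.
  by apply: sumr_ge0 => l _; rewrite ltW.
rewrite -(ltr_pM2r sw0) mulr_sumr.
under eq_bigr do rewrite -wA; rewrite exchange_big /=.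
apply: le_lt_trans (_ : _ <= k * \sum_i w i) _; last by rewrite ltr_pM2r.
rewrite mulr_sumr; apply: ler_sum => j _.
rewrite -mulr_suml ler_pM2r //; apply: le_trans (kG j).
by apply: ler_sum => i _; rewrite mxE powRr1.
Qed.

(** The matrix at a small exponent is close to its 0-1 pattern [D], whose radius
    exceeds 1: otherwise the left eigenvector [v] of [D] would satisfy
    [v_a <= v_b] along each edge from [a] to [b], hence be constant, since the
    graph is strongly connected, and column [j] would then contain only one 1. *)
Lemma radius_gt1_near0 (j i i' : 'I_n.+1) : i != i' -> 0 < G i j -> 0 < G i' j ->
  exists t, [/\ 0 < t, t < 1 & 1 < rho t].
Proof.
move=> ii' Gij Gi'j.
pose D : 'M[R]_n.+1 := \matrix_(a, b) (0 < G a b)%R%:R.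
have D_ge0 a b : 0 <= D a b by rewrite mxE ler0n.
have DG a b : (0 < D a b) = (0 < G a b).
  by rewrite mxE; case: (0 < G a b); rewrite ?ltr01 ?ltxx.
have irrD : irreducible_mx D.
  by apply: irreducible_pattern irrG => // a b; rewrite DG.
have [v [w [v0 w0 vA wA]]] := perron_frobenius D_ge0 irrD.
have D1 : 1 < spectral_radius D.
  rewrite ltNge; apply/negP => D1.
  have vD b : \sum_a v a * D a b <= v b by rewrite vA ler_piMl // ltW.
  have vle a b : v a <= v b.
    apply: (@irreducible_backward_closed _ _ D (fun a => v a <= v b)
      D_ge0 irrD _ a b) => // {}a c Dac.
    apply: le_trans; apply: le_trans (vD c).
    rewrite (bigD1 a) //= -[leLHS]addr0 lerD //.
      by move: Dac; rewrite DG mxE => ->; rewrite mulr1.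
    by apply: sumr_ge0 => l _; rewrite mulr_ge0 // ltW.
  have := vD j; rewrite (bigD1 i) //= (bigD1 i') 1?eq_sym //= !mxE Gij Gi'j !mulr1.
  have : 0 <= \sum_(l | (l != i) && (l != i')) v l * D l j.
    by apply: sumr_ge0 => l _; rewrite mulr_ge0 // ltW.
  have := v0 i; have := vle j i; have := vle j i'; have := v0 j; lra.
have [m [m0 m1 mG]] := positive_entry_lower_bound.
have [||t [t0 t1 tm]] := @powR_close_to_1 _ m (spectral_radius D)^-1.
- by rewrite m0.
- by rewrite invf_lt1 // (lt_trans ltr01).
exists t; split; [exact: t0 | exact: t1 | ].
apply: lt_le_trans (_ : 1 < m `^ t * spectral_radius D) _.
  by rewrite -ltr_pdivrMr ?mul1r // (lt_trans ltr01).
apply: (spectral_radius_ge (mx_powR_ge0 _) (mx_powR_irreducible _) w0) => a.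
rewrite -mulrA -wA mulr_sumr; apply: ler_sum => b _.
rewrite mulrA ler_pM2r // !mxE.
have [Gab|Gab] := ltP 0 (G a b); last by rewrite mulr0 powR_ge0.
by rewrite mulr1; apply: ge0_ler_powR; rewrite ?nnegrE ?mG // ltW.
Qed.

Lemma radius_nonincreasing t t' : 0 < t -> t <= t' -> rho t' <= rho t.
Proof.
move=> t0 tt'; have [k [k0 k1 kG]] := entry_upper_bound.
have h0 : 0 <= t' - t by rewrite subr_ge0.
have := radius_decay t0 h0 kG; rewrite addrC subrK; move/le_trans; apply.
rewrite ler_piMl ?spectral_radius_ge0 //.
- exact: mx_powR_ge0.
- exact: mx_powR_irreducible.
by rewrite -(powRr0 k) ger_powR // k0 ltW.
Qed.

Lemma radius_root_exists a : 0 < a -> a < 1 -> 1 < rho a -> rho 1 < 1 ->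
  exists t, [/\ 0 < t, t < 1 & rho t = 1].
Proof.
move=> a0 a1 ra r1.
have [m [m0 m1 mG]] := positive_entry_lower_bound.
have [|||t [at_ t1 rt]] :=
  @slowly_decreasing_hits_1 _ (fun t => rho t) m a 1 _ _ ra.
- by rewrite m0.
- by move=> t h at_ h0; apply: radius_growth => //; exact: lt_le_trans at_.
- by move=> t t1; apply: le_lt_trans r1; apply: radius_nonincreasing t1.
by exists t; split; [exact: lt_le_trans at_ | exact: t1 | exact: rt].
Qed.
End PowerFamily.

(** * The weight matrix and the two exponents *)

Section WeightMatrix.
Variables (R : realType) (n : nat) (P : 'M[R]_n.+1).
Variables (lip : 'I_n.+1 -> 'I_n.+1 -> R) (r : R).
Hypotheses (P_stochastic : stochastic P) (irrP : irreducible_mx P).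
Hypothesis lip01 : forall i j, 0 < lip i j < 1.
Hypothesis r_gt0 : 0 < r.

(** The indices are transposed with respect to [P], since the map of index [ij] is
    used with the probability of the transition from [j] to [i]. *)
Definition weight_mx : 'M[R]_n.+1 := \matrix_(i, j) (P j i * lip i j `^ r).

Lemma stochastic_le1 i j : P i j <= 1.
Proof.
have [P0 P1] := P_stochastic; rewrite -(P1 i) (bigD1 j) //= lerDl.
exact: sumr_ge0.
Qed.

Lemma lip_powR_lt1 i j : lip i j `^ r < 1.
Proof.
have /andP[l0 l1] := lip01 i j.
have -> : 1 = 1 `^ r :> R by rewrite powR1.
by apply: gt0_ltr_powR; rewrite ?nnegrE // ltW.
Qed.

Lemma weight_ge0 i j : 0 <= weight_mx i j.
Proof. by rewrite mxE mulr_ge0 ?powR_ge0 //; case: P_stochastic. Qed.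

Lemma weight_gt0 i j : (0 < weight_mx i j) = (0 < P j i).
Proof.
rewrite mxE pmulr_lgt0 // powR_gt0 //; by case/andP: (lip01 i j).
Qed.

Lemma weight_lt1 i j : weight_mx i j < 1.
Proof.
rewrite mxE; apply: le_lt_trans (lip_powR_lt1 i j).
by rewrite ler_piMl ?powR_ge0 // stochastic_le1.
Qed.

Lemma weight_irreducible : irreducible_mx weight_mx.
Proof.
have [P0 _] := P_stochastic.
apply: irreducible_pattern (irreducible_trmx irrP) => i j.
- by rewrite mxE.
- exact: weight_ge0.
- by rewrite weight_gt0 mxE.
Qed.

Lemma weight_radius_lt1 : spectral_radius (mx_powR weight_mx 1) < 1.
Proof.
have [P0 P1] := P_stochastic.
have H : forall ij : 'I_n.+1 * 'I_n.+1, predT ij -> 0 < 1 - lip ij.1 ij.2 `^ r.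
  by move=> ij _; rewrite subr_gt0 lip_powR_lt1.
have [e [e0 e1 eP]] := finite_positive_lower_bound H.
apply: (@radius_lt1_col_sums _ _ weight_mx weight_ge0 weight_irreducible (1 - e)).
  by rewrite ltrBlDr ltrDl.
move=> j; rewrite -[leRHS]mul1r -[X in X * _](P1 j) mulr_suml; apply: ler_sum => i _.
by rewrite mxE ler_wpM2l // lerBrDr -lerBrDl; exact: (eP (i, j)).
Qed.

(** Otherwise each row has a single positive entry, necessarily equal to 1, at a
    column [s j]. Irreducibility makes [s] surjective, hence a permutation. *)
Lemma row_with_two_positive_entries : ~~ is_perm_mx P ->
  exists j i i', [/\ i != i', 0 < P j i & 0 < P j i'].
Proof.
have [P0 P1] := P_stochastic.
move=> notperm; apply: contrapT => no2; move: notperm; apply/negP; rewrite negbK.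
have /choice [s sP] : forall j, exists i, 0 < P j i.
  move=> j; apply/existsP; apply: contraT => /existsPn noP.
  have : \sum_i P j i <= 0 by apply: sumr_le0 => i _; rewrite leNgt noP.
  by rewrite P1 ler10.
have Ps0 j i : i != s j -> P j i = 0.
  move=> ij; apply/eqP; rewrite eq_le P0 andbT leNgt; apply/negP => Pji.
  by apply: no2; exists j, i, (s j).
have Ps1 j : P j (s j) = 1.
  by rewrite -(P1 j) (bigD1 (s j)) //= big1 ?addr0 // => i /Ps0.
have /choice [g sg] : forall i, exists j, s j = i.
  move=> i; have [j] := irreducible_col_positive i P0 irrP.
  have [->|/Ps0->] := eqVneq i (s j); last by rewrite ltxx.
  by move=> _; exists j.
have s_inj : injective s.
  have g_bij : bijective g by apply: injF_bij; exact: can_inj sg.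
  by apply: (@can_inj _ _ _ g); apply/(bij_can_sym g_bij).
apply/is_perm_mxP; exists (perm s_inj); apply/matrixP => j i.
rewrite !mxE permE; have [<-|ij] := eqVneq (s j) i; first by rewrite Ps1.
by rewrite Ps0 // eq_sym.
Qed.

(** The map from [l] to [l / (r + l)] is a bijection from the positive numbers
    onto the open unit interval, with inverse [r t / (1 - t)]. *)
Lemma dimension_exponent_unique_exists : ~~ is_perm_mx P ->
  exists! l : R, 0 < l /\ spectral_radius (mx_powR weight_mx (l / (r + l))) = 1.
Proof.
move=> /row_with_two_positive_entries [j [i [i' [ii' Pi Pi']]]].
have [a [a0 a1 ra]] : exists t, [/\ 0 < t, t < 1 &
    1 < spectral_radius (mx_powR weight_mx t)].
  by apply: (radius_gt1_near0 weight_ge0 weight_irreducible ii' (j := j));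
    rewrite weight_gt0.
have [t [t0 t1 rt]] := radius_root_exists weight_ge0 weight_lt1
  weight_irreducible a0 a1 ra weight_radius_lt1.
have t1' : 1 - t != 0 by rewrite subr_eq0 gt_eqF.
have lt_ : r * t / (1 - t) / (r + r * t / (1 - t)) = t.
  have r0 : r != 0 by rewrite gt_eqF.
  by field; rewrite t1' /= -mulrDr subrK mulr1.
exists (r * t / (1 - t)); split.
  by rewrite lt_; split; [rewrite divr_gt0 ?mulr_gt0 ?subr_gt0 | exact: rt].
move=> l [l0 rl].
have rl0 : 0 < r + l by rewrite addr_gt0.
have tl0 : 0 < l / (r + l) by rewrite divr_gt0.
rewrite (radius_root_unique weight_ge0 weight_lt1 weight_irreducible t0 tl0 rt rl).
have r0 : r != 0 by rewrite gt_eqF.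
by field; rewrite addrK r0 gt_eqF.
Qed.

End WeightMatrix.

(** * Euclidean distance and the norm topology *)

Section EuclideanDistance.
Variables (R : realType) (k : nat).
Implicit Types (x y z : 'rV[R]_k) (A : set 'rV[R]_k).

Lemma eucl_dist_ge0 x y : 0 <= eucl_dist x y.
Proof. exact: sqrtr_ge0. Qed.

Lemma eucl_distxx x : eucl_dist x x = 0.
Proof.
by rewrite /eucl_dist big1 ?sqrtr0 // => i _; rewrite subrr expr0n.
Qed.

Lemma eucl_distC x y : eucl_dist x y = eucl_dist y x.
Proof.
rewrite /eucl_dist; congr Num.sqrt; apply: eq_bigr => i _.
by rewrite -sqrrN opprB.
Qed.

(** Lagrange's identity: the difference of the two sides is half the sum of the
    squares of the minors [a i * b j - a j * b i]. *)
Lemma sum_cauchy_schwarz (a b : 'I_k -> R) :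
  (\sum_i a i * b i) ^+ 2 <= (\sum_i a i ^+ 2) * (\sum_i b i ^+ 2).
Proof.
have : 0 <= \sum_i \sum_j (a i * b j - a j * b i) ^+ 2.
  by apply: sumr_ge0 => i _; apply: sumr_ge0 => j _; exact: sqr_ge0.
have -> : \sum_i \sum_j (a i * b j - a j * b i) ^+ 2 =
    ((\sum_i a i ^+ 2) * (\sum_i b i ^+ 2) - (\sum_i a i * b i) ^+ 2) *+ 2.
  transitivity (\sum_i \sum_j (a i ^+ 2 * b j ^+ 2) +
    \sum_i \sum_j (a j ^+ 2 * b i ^+ 2) -
    (\sum_i \sum_j (a i * b i) * (a j * b j)) *+ 2).
    rewrite -big_split -sumrMnl -sumrB; apply: eq_bigr => i _ /=.
    rewrite -big_split -sumrMnl -sumrB; apply: eq_bigr => j _ /=.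
    by ring.
  rewrite [X in _ + X - _]exchange_big /= -!big_distrlr /=; ring.
by rewrite pmulrn_lge0 // subr_ge0.
Qed.

Lemma eucl_dist_triangle y x z :
  eucl_dist x z <= eucl_dist x y + eucl_dist y z.
Proof.
rewrite -[leRHS]ger0_norm ?addr_ge0 ?eucl_dist_ge0 // -sqrtr_sqr.
rewrite ler_sqrt ?sqr_ge0 // sqrrD !sqr_sqrtr; last 2 first.
- by apply: sumr_ge0 => i _; exact: sqr_ge0.
- by apply: sumr_ge0 => i _; exact: sqr_ge0.
pose a i := x 0 i - y 0 i; pose b i := y 0 i - z 0 i.
have -> : \sum_i (x 0 i - z 0 i) ^+ 2 =
    \sum_i a i ^+ 2 + (\sum_i a i * b i) *+ 2 + \sum_i b i ^+ 2.
  rewrite -sumrMnl -!big_split /=; apply: eq_bigr => i _; rewrite /a /b; ring.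
rewrite lerD2r lerD2l lerMn2r /=.
apply: le_trans (ler_norm _) _.
rewrite -sqrtr_sqr -sqrtrM; last by apply: sumr_ge0 => i _; exact: sqr_ge0.
by rewrite ler_wsqrtr // sum_cauchy_schwarz.
Qed.

Lemma norm_le_eucl_dist x y : `|x - y| <= eucl_dist x y.
Proof.
rewrite /Num.norm /= mx_normrE bigmax_le ?eucl_dist_ge0 // => -[i j] _ /=.
rewrite (ord1 i) !mxE -sqrtr_sqr ler_wsqrtr //.
by rewrite (bigD1 j) //= lerDl sumr_ge0 // => l _; exact: sqr_ge0.
Qed.

Lemma eucl_dist_le_norm x y : eucl_dist x y <= Num.sqrt k%:R * `|x - y|.
Proof.
rewrite -[X in _ * X]normr_id -(sqrtr_sqr `|x - y|) -sqrtrM ?ler0n //.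
apply: ler_wsqrtr; rewrite mulr_natl.
have <- : \sum_(i < k) `|x - y| ^+ 2 = `|x - y| ^+ 2 *+ k.
  by rewrite sumr_const card_ord.
apply: ler_sum => i _; rewrite -ler_sqrt ?sqr_ge0 // !sqrtr_sqr normr_id.
rewrite [leRHS]/Num.norm /= mx_normrE.
by apply: le_trans (le_bigmax _ _ (ord0, i)); rewrite /= !mxE.
Qed.

Lemma eucl_dist_set_ge0 x A : 0 <= eucl_dist_set x A.
Proof.
have [->|/set0P [a Aa]] := eqVneq A set0.
  by rewrite /eucl_dist_set image_set0 inf0.
apply: lb_le_inf; first by exists (eucl_dist x a), a.
by move=> _ [b _ <-]; exact: eucl_dist_ge0.
Qed.

Lemma eucl_dist_set_le x a A : A a -> eucl_dist_set x A <= eucl_dist x a.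
Proof.
move=> Aa; apply: ge_inf; last by exists a.
by exists 0 => _ [b _ <-]; exact: eucl_dist_ge0.
Qed.

Lemma eucl_dist_set_ge x A (e : R) : A !=set0 ->
  (forall a, A a -> e <= eucl_dist x a) -> e <= eucl_dist_set x A.
Proof.
move=> [a Aa] eA; apply: lb_le_inf; first by exists (eucl_dist x a), a.
by move=> _ [b Ab <-]; exact: eA.
Qed.

Lemma eucl_dist_set_lipschitz x y A : A !=set0 ->
  eucl_dist_set x A <= eucl_dist_set y A + eucl_dist x y.
Proof.
move=> A0; rewrite -lerBlDr; apply: eucl_dist_set_ge => // a Aa.
rewrite lerBlDr addrC; apply: le_trans (eucl_dist_triangle y _ _).
exact: eucl_dist_set_le.
Qed.

Lemma eucl_dist_set_continuous A : A !=set0 ->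
  continuous (fun x => eucl_dist_set x A).
Proof.
move=> A0 x; apply/(@cvgrPdist_le _ _ _ _ (nbhs_filter x)) => e e0.
pose c : R := Num.sqrt k%:R + 1.
have c0 : 0 < c by rewrite ltr_wpDl ?sqrtr_ge0.
have lip y : eucl_dist x y <= c * `|x - y|.
  apply: le_trans (eucl_dist_le_norm _ _) _.
  by rewrite ler_wpM2r // lerDl.
near=> y.
have xy : eucl_dist x y <= e.
  apply: le_trans (lip y) _; rewrite mulrC -ler_pdivlMr //.
  near: y; apply/nbhs_ballP; exists (e / c); first exact: divr_gt0.
  by move=> y; rewrite mx_norm_ball => /ltW.
have := eucl_dist_set_lipschitz x y A0; have := eucl_dist_set_lipschitz y x A0.
rewrite (eucl_distC y) ler_norml => h1 h2; apply/andP; split; lra.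
Unshelve. all: by end_near. Qed.

Lemma eucl_dist_compact_bounded A : compact A ->
  exists2 D : R, 0 < D & forall x y, A x -> A y -> eucl_dist x y <= D.
Proof.
move=> /compact_bounded [M [_ MA]].
pose M1 : R := `|M| + 1.
have M1A x : A x -> `|x| <= M1.
  by apply: (MA M1); rewrite /M1 (le_lt_trans (ler_norm _)) // ltrDl.
have M10 : 0 < M1 by rewrite ltr_wpDl.
exists ((Num.sqrt k%:R + 1) * (M1 + M1)).
  by apply: mulr_gt0; [rewrite ltr_wpDl ?sqrtr_ge0 | rewrite addr_gt0].
move=> x y Ax Ay; apply: le_trans (eucl_dist_le_norm _ _) _.
apply: ler_pM; rewrite ?sqrtr_ge0 // ?lerDl //.
by apply: le_trans (ler_normB _ _) _; apply: lerD; exact: M1A.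
Qed.

(** The distance to [B] attains its minimum on [A] at a point [a], and the
    distance to [a] attains its minimum on [B]. *)
Lemma eucl_dist_compact_disjoint A B : compact A -> compact B ->
  A `&` B = set0 ->
  exists2 e : R, 0 < e & forall x y, A x -> B y -> e <= eucl_dist x y.
Proof.
move=> cA cB AB0.
have [->|/set0P A0] := eqVneq A set0; first by exists 1.
have [->|/set0P B0] := eqVneq B set0; first by exists 1.
have [a + aP] := @compact_EVT_min _ R (fun x => eucl_dist_set x B) A A0 cA
  (continuous_subspaceT (eucl_dist_set_continuous B0)).
rewrite inE => Aa.
have cont_a : continuous (fun x => eucl_dist_set x [set a]).
  by apply: eucl_dist_set_continuous; exists a.
have [b + bP] := @compact_EVT_min _ R _ B B0 cB (continuous_subspaceT cont_a).
rewrite inE => Bb.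
have dset1 x : eucl_dist_set x [set a] = eucl_dist x a.
  apply/eqP; rewrite eq_le eucl_dist_set_le //=.
  by apply: eucl_dist_set_ge => [|_ ->]; [exists a|].
have ab : 0 < eucl_dist a b.
  rewrite lt_neqAle eucl_dist_ge0 andbT eq_sym; apply/negP => /eqP ab0.
  have : `|a - b| <= 0 by rewrite -ab0 norm_le_eucl_dist.
  rewrite normr_le0 subr_eq0 => /eqP abE.
  by have : (A `&` B) a by [split => //; rewrite abE]; rewrite AB0.
exists (eucl_dist a b) => // x y Ax By.
apply: le_trans (_ : eucl_dist_set a B <= _).
  apply: eucl_dist_set_ge => // b' Bb'.
  have := bP b'; rewrite !dset1 inE => /(_ Bb').
  by rewrite !(eucl_distC a).
apply: le_trans (aP x _) _; first by rewrite inE.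
exact: eucl_dist_set_le.
Qed.

End EuclideanDistance.

(** * Words and cuts of the tree of words *)

Section Words.
Variables (R : realType) (n : nat).
Local Notation letter := 'I_n.+1.
Implicit Types (w : letter -> letter -> R) (i j : letter) (s : seq letter).

(** A nonempty word is given by its first letter [i] and the sequence [s] of the
    other letters; its last letter is [last i s]. *)
Fixpoint word_prod w i s : R :=
  if s is j :: s' then w i j * word_prod w j s' else 1.

Lemma word_prod_cat w i s s' :
  word_prod w i (s ++ s') = word_prod w i s * word_prod w (last i s) s'.
Proof. by elim: s i => [|j s IH] i /=; rewrite ?mul1r // IH mulrA. Qed.

Lemma word_prodM w w' i s :
  word_prod (fun i j => w i j * w' i j) i s = word_prod w i s * word_prod w' i s.
Proof.
by elim: s i => [|j s IH] i /=; rewrite ?mulr1 // IH mulrACA.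
Qed.

Lemma word_prod_ge0 w i s : (forall i j, 0 <= w i j) -> 0 <= word_prod w i s.
Proof. by move=> w0; elim: s i => [|j s IH] i //=; rewrite mulr_ge0. Qed.

Lemma word_prod_gt0 w i s : (forall i j, 0 < w i j) -> 0 < word_prod w i s.
Proof. by move=> w0; elim: s i => [|j s IH] i //=; rewrite mulr_gt0. Qed.

Lemma word_prod_powR w (t : R) i s : (forall i j, 0 <= w i j) ->
  word_prod (fun i j => w i j `^ t) i s = word_prod w i s `^ t.
Proof.
move=> w0; elim: s i => [|j s IH] i /=; first by rewrite powR1.
by rewrite powRM ?word_prod_ge0 // IH.
Qed.

Lemma word_prod_le w (c : R) i s : (forall i j, 0 <= w i j <= c) ->
  word_prod w i s <= c ^+ size s.
Proof.
move=> wc; have w0 a b : 0 <= w a b by case/andP: (wc a b).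
elim: s i => [|j s IH] i /=; first by rewrite expr0.
by rewrite exprS ler_pM ?word_prod_ge0 //; case/andP: (wc i j).
Qed.

Lemma word_prod_cons_gt0 w i j s : (forall i j, 0 <= w i j) ->
  (0 < word_prod w i (j :: s)) = (0 < w i j) && (0 < word_prod w j s).
Proof.
move=> w0 /=; have := w0 i j; rewrite le_eqVlt => /predU1P[<-|wij].
  by rewrite mul0r ltxx.
by rewrite pmulr_rgt0 // wij.
Qed.

Definition prefix_of (x : nat -> letter) i s : Prop :=
  forall l, (l <= size s)%N -> x l = nth ord0 (i :: s) l.

End Words.

Lemma exists_exp_le (R : realType) (k e : R) : 0 <= k < 1 -> 0 < e ->
  exists q : nat, k ^+ q <= e.
Proof.
move=> /andP[k0 k1] e0.
have /cvgrPdist_le/(_ e e0)[N _ /(_ N (leqnn N))] : (k ^+ q) @[q --> \oo] --> 0.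
  by apply: cvg_expr; rewrite ger0_norm.
rewrite sub0r normrN ger0_norm ?exprn_ge0 // => ?; by exists N.
Qed.

Lemma natr_sum_seq (R : pzRingType) (T : Type) (L : seq T) (F : T -> nat) :
  (sumn [seq F x | x <- L])%:R = \sum_(x <- L) (F x)%:R :> R.
Proof. by rewrite sumnE big_map natr_sum. Qed.

Section Antichains.
Variables (R : realType) (n : nat) (G : 'M[R]_n.+1) (t k : R).
Hypotheses (G_ge0 : forall i j, 0 <= G i j) (k01 : 0 < k < 1).
Hypothesis G_le : forall i j, G i j <= k.
Hypothesis t_gt0 : 0 < t.
Local Notation letter := 'I_n.+1.

(** The tree of words cut where the weight first falls to [e] or below. The
    estimate for the number of words is proved together with the existence of
    the cut, by induction on a number [q] of letters that suffices to bring the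
    weight down to [e]. Behind the first edge, of weight [G i j], the threshold
    becomes [e / G i j], and the bounds for the subtrees add up to the bound for
    the tree because [v] is excessive for the matrix of the [G i j `^ t]. *)
Lemma covering_words (v : letter -> R) : (forall i, 0 < v i) ->
  (forall i, \sum_j G i j `^ t * v j <= v i) ->
  exists2 K : R, 0 < K & forall e, 0 < e <= 1 -> forall i,
    exists L : seq (seq letter),
    [/\ forall x : nat -> letter, x 0 = i ->
          (forall l, 0 < G (x l) (x l.+1)) ->
          exists2 s, s \in L & prefix_of x i s,
        (size L)%:R <= K * e `^ (- t) &
        forall s, s \in L -> word_prod G i s <= e].
Proof.
move=> v0 vG; have [m [m0 m1 mG]] := positive_entry_lower_bound G.
have [v_ [v_0 _ v_le]] :=
  @finite_positive_lower_bound R _ predT v (fun i _ => v0 i).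
(* The smallest constant for which one word is allowed at the threshold [m^-1]. *)
pose K := (v_ * m `^ t)^-1.
have K0 : 0 < K by rewrite invr_gt0 mulr_gt0 ?powR_gt0.
pose good e i L :=
  [/\ forall x : nat -> letter, x 0 = i ->
        (forall l, 0 < G (x l) (x l.+1)) ->
        exists2 s, s \in L & prefix_of x i s,
      (size L)%:R <= K * v i * e `^ (- t) &
      forall s, s \in L -> word_prod G i s <= e].
suff claim q : forall e, 0 < e -> k ^+ q <= e -> e <= m^-1 -> forall i,
    exists L, good e i L.
  pose V := \sum_i v i.
  have vV i : v i <= V.
    by rewrite /V (bigD1 i) //= lerDl sumr_ge0 // => j _; exact: ltW.
  exists (K * V) => [|e /andP[e0 e1] i].
    by rewrite mulr_gt0 // (lt_le_trans (v0 ord0)).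
  have [q qe] : exists q, k ^+ q <= e.
    by apply: exists_exp_le e0; case/andP: k01 => /ltW -> ->.
  have [|L [L1 L2 L3]] := claim q e e0 qe _ i.
    by rewrite (le_trans e1) // invf_ge1.
  exists L; split => //; apply: le_trans L2 _.
  by rewrite ler_wpM2r ?powR_ge0 // ler_wpM2l // ltW.
(* A threshold that exceeds 1 is met by the empty word; the division by an entry
   never pushes the threshold beyond [m^-1]. *)
have base e i : 1 <= e -> e <= m^-1 -> exists L, good e i L.
  move=> e1 em; have e0 : 0 < e by exact: lt_le_trans e1.
  exists [:: [::]]; split => [x x0 _|/=|s].
  - by exists [::]; [rewrite inE | case].
  - rewrite powRN ler_pdivlMr ?powR_gt0 // mul1r.
    apply: le_trans (_ : m^-1 `^ t <= _).
      by apply: ge0_ler_powR; rewrite ?nnegrE ?invr_ge0 // ltW.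
    rewrite -powR_inv1 ?(ltW m0) // -powRrM mulN1r powRN /K invfM mulrAC.
    by rewrite ler_peMl ?invr_ge0 ?powR_ge0 // mulrC ler_pdivlMr // mul1r v_le.
  - by rewrite inE => /eqP ->.
elim: q => [|q IH] e e0 qe em i; (have [e1|e1] := leP 1 e; first exact: base).
  by move: qe; rewrite expr0 leNgt e1.
have /choice [L_ LP] : forall j, exists L : seq (seq letter), 0 < G i j ->
    good (e / G i j) j L.
  move=> j; have [Gij|Gij] := ltP 0 (G i j); last by exists [::].
  have [|||L LP] := IH (e / G i j) _ _ _ j.
  - by rewrite divr_gt0.
  - rewrite ler_pdivlMr // (le_trans _ qe) // exprSr.
    by rewrite ler_wpM2l // exprn_ge0 // ltW //; case/andP: k01.
  - apply: le_trans (_ : (G i j)^-1 <= _).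
      by rewrite ler_piMl ?invr_ge0 // ltW.
    by rewrite lef_pV2 ?posrE // mG.
  by exists L.
exists [seq j :: s | j <- [seq j <- enum 'I_n.+1 | 0 < G i j], s <- L_ j]; split.
- move=> x x0 xG; have x01 : 0 < G i (x 1%N) by rewrite -x0.
  have [L1 _ _] := LP _ x01.
  have [s sL sx] := L1 (fun l => x l.+1) erefl (fun l => xG l.+1).
  exists (x 1%N :: s).
    by apply/allpairsPdep; exists (x 1%N), s; rewrite mem_filter mem_enum x01.
  by move=> [|l] //= ls; rewrite sx.
- rewrite size_allpairs_dep natr_sum_seq big_filter big_enum_cond /=.
  rewrite -mulrA; apply: le_trans
    (_ : _ <= K * ((\sum_j G i j `^ t * v j) * e `^ (- t))) _.
    rewrite mulr_suml mulr_sumr [leLHS]big_mkcond /=; apply: ler_sum => j _.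
    case: ifPn => [Gij|_]; last first.
      by rewrite !mulr_ge0 ?powR_ge0 // ltW.
    have [_ + _] := LP _ Gij; move/le_trans; apply.
    rewrite powRM ?invr_ge0 ?(ltW e0) ?(ltW Gij) //.
    rewrite -[in X in X <= _]powR_inv1 ?(ltW Gij) // -powRrM mulN1r opprK.
    by rewrite [e `^ _ * _]mulrC mulrA [K * v j * _]mulrAC -!mulrA.
  by rewrite ler_wpM2l ?(ltW K0) // ler_wpM2r ?powR_ge0.
- move=> s /allpairsPdep [j [s' [+ s'L ->]]].
  rewrite mem_filter => /andP[Gij _] /=.
  have [_ _ L3] := LP _ Gij; have := L3 _ s'L.
  by rewrite ler_pdivlMr // mulrC.
Qed.

End Antichains.

(** * Compositions of the maps along words *)

Section WordMaps.
Variables (R : realType) (k n : nat) (I : bilipschitz_rifs R k n).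
Variable E : 'I_n.+2 -> set 'rV[R]_k.
Hypothesis limE : limit_sets I E.
Local Notation letter := 'I_n.+2.
Local Notation f := (rifs_map I).
Local Notation X := (rifs_space I).
Implicit Types (i j : letter) (s : seq letter) (x y : 'rV[R]_k).

Definition transition i j : R := rifs_mx I j i.

Fixpoint compose_word i s x : 'rV[R]_k :=
  if s is j :: s' then f i j (compose_word j s' x) else x.

Local Notation prob := (word_prod transition).

Lemma transition_ge0 i j : 0 <= transition i j.
Proof. by have [P0 _] := rifs_mx_stochastic I; exact: P0. Qed.

Lemma lower_lip_gt0 i j : 0 < lower_lip I i j.
Proof. by have [] := lip_bounds I i j. Qed.

Lemma lower_lip01 i j : 0 < lower_lip I i j < 1.
Proof.
by have [c0 cs s1] := lip_bounds I i j; rewrite c0 (le_lt_trans cs).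
Qed.

Lemma upper_lip01 i j : 0 < upper_lip I i j < 1.
Proof.
by have [c0 cs s1] := lip_bounds I i j; rewrite s1 (lt_le_trans c0).
Qed.

Lemma upper_lip_gt0 i j : 0 < upper_lip I i j.
Proof. by case/andP: (upper_lip01 i j). Qed.

Lemma limit_set_space i x : E i x -> X x.
Proof. by have [_ _ + _] := limE i; apply. Qed.

Lemma compose_word_cat i s s' x :
  compose_word i (s ++ s') x = compose_word i s (compose_word (last i s) s' x).
Proof. by elim: s i => [|j s IH] i //=; rewrite IH. Qed.

Lemma compose_word_space i s x : X x -> X (compose_word i s x).
Proof. by move=> Xx; elim: s i => [|j s IH] i //=; exact: rifs_map_space. Qed.

Lemma compose_word_limit_set i s x : 0 < prob i s -> E (last i s) x ->
  E i (compose_word i s x).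
Proof.
elim: s i => [|j s IH] i //; rewrite word_prod_cons_gt0; last exact: transition_ge0.
move=> /andP[ij ps] Ex /=; have [_ _ _ ->] := limE i.
by exists j => //; exists (compose_word j s x) => //; exact: IH.
Qed.

Lemma compose_word_bilipschitz i s x y : X x -> X y ->
  word_prod (lower_lip I) i s * eucl_dist x y <=
    eucl_dist (compose_word i s x) (compose_word i s y) /\
  eucl_dist (compose_word i s x) (compose_word i s y) <=
    word_prod (upper_lip I) i s * eucl_dist x y.
Proof.
move=> Xx Xy; elim: s i => [|j s IH] i /=; first by rewrite !mul1r.
have [IH1 IH2] := IH j.
have [H1 H2] := rifs_map_bilipschitz i j (compose_word_space j s Xx)
  (compose_word_space j s Xy).
split; rewrite -mulrA.
  by apply: le_trans H1; rewrite ler_wpM2l // ltW // lower_lip_gt0.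
by apply: le_trans H2 _; rewrite ler_wpM2l // ltW // upper_lip_gt0.
Qed.

(** Each point of a limit set has a code of any length. *)
Lemma limit_set_address m i x : E i x -> exists s,
  [/\ size s = m, 0 < prob i s &
      exists2 y, E (last i s) y & x = compose_word i s y].
Proof.
elim: m i x => [|m IH] i x Ex.
  by exists [::]; split; rewrite /= ?ltr01 //; exists x.
have [_ _ _ EE] := limE i; move: Ex; rewrite EE => -[j /= ij [z Ez <-]].
have [s [sm ps [y Ey zE]]] := IH j z Ez.
exists (j :: s); split; rewrite /= ?sm //; first by rewrite mulr_gt0.
by exists y; rewrite ?zE.
Qed.

Lemma upper_lip_bound : exists2 c : R, 0 < c < 1 & forall i j, upper_lip I i j <= c.
Proof.
have H : forall ij : letter * letter, predT ij -> 0 < 1 - upper_lip I ij.1 ij.2.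
  by move=> ij _; rewrite subr_gt0; case/andP: (upper_lip01 ij.1 ij.2).
have [e [e0 e1 eP]] := finite_positive_lower_bound H.
exists (1 - e / 2) => [|i j]; first by apply/andP; split; lra.
have : e <= 1 - upper_lip I i j by exact: (eP (i, j)).
lra.
Qed.

Lemma compose_word_contracts (rad : R) : 0 < rad -> exists q, forall i s x y,
  (q <= size s)%N -> X x -> X y ->
  eucl_dist (compose_word i s x) (compose_word i s y) < rad.
Proof.
move=> rad0.
have [D D0 XD] := eucl_dist_compact_bounded (@rifs_space_compact _ _ _ I).
have [c c01 sc] := upper_lip_bound; have /andP[c0 c1] := c01.
have [q qe] : exists q, c ^+ q <= rad / 2 / D.
  by apply: exists_exp_le; rewrite ?divr_gt0 // c1 ltW.
exists q => i s x y qs Xx Xy.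
have [_ /le_lt_trans->//] := compose_word_bilipschitz i s Xx Xy.
apply: le_lt_trans (_ : c ^+ q * D < _).
  rewrite ler_pM ?word_prod_ge0 ?eucl_dist_ge0 //; last exact: XD.
    by move=> a b; exact: ltW (upper_lip_gt0 a b).
  apply: (@le_trans _ _ (c ^+ size s)).
    by apply: word_prod_le => a b; rewrite sc ltW // upper_lip_gt0.
  by apply: ler_wiXn2l => //; exact: ltW.
apply: le_lt_trans (_ : rad / 2 < _).
  by rewrite -ler_pdivlMr.
by rewrite ltr_pdivrMr // ltr_pMr // ltr1n.
Qed.

Lemma compose_word_compact i s : compact (compose_word i s @` E (last i s)).
Proof.
apply: continuous_compact; last by have [] := limE (last i s).
apply/subspace_continuousP => x Ex.
apply/cvgrPdist_le => e e0.
pose c : R := word_prod (upper_lip I) i s * (Num.sqrt k%:R + 1).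
have c0 : 0 < c.
  by rewrite mulr_gt0 ?word_prod_gt0 ?ltr_wpDl ?sqrtr_ge0 //; exact: upper_lip_gt0.
rewrite near_withinE; apply/nbhs_ballP; exists (e / c); first exact: divr_gt0.
move=> y; rewrite mx_norm_ball /ball_ /= => xy Ey.
apply: le_trans (norm_le_eucl_dist _ _) _.
have [_ /le_trans->//] := compose_word_bilipschitz i s
  (limit_set_space Ex) (limit_set_space Ey).
apply: le_trans (_ : c * `|x - y| <= _).
  rewrite -mulrA ler_wpM2l ?word_prod_ge0 //.
    by move=> a b; exact: ltW (upper_lip_gt0 a b).
  by apply: le_trans (eucl_dist_le_norm _ _) _; rewrite ler_wpM2r // lerDl.
by rewrite mulrC -ler_pdivlMr // ltW.
Qed.

Section OpenSets.
Variable U : letter -> set 'rV[R]_k.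
Hypothesis U_open : forall i, open (U i).
Hypothesis U_space : forall i, U i `<=` X.
Hypothesis U_disj : forall i j i' j', (i, j) <> (i', j') ->
  (f i j @` U j) `&` (f i' j' @` U j') = set0.
Hypothesis U_image : forall i j, f i j @` U j `<=` U i.
Hypothesis EU : forall i, E i `&` U i !=set0.

Lemma compose_word_open_set i s x : U (last i s) x -> U i (compose_word i s x).
Proof.
elim: s i => [|j s IH] i //= Ux; apply: U_image.
by exists (compose_word j s x) => //; exact: IH.
Qed.

(** At the first letter where the words differ the images of the open sets are
    disjoint, and the maps before it are injective. *)
Lemma compose_word_open_set_neq i s s' x y : size s = size s' -> s <> s' ->
  U (last i s) x -> U (last i s') y -> compose_word i s x <> compose_word i s' y.
Proof.
elim: s s' i => [|j s IH] [|j' s'] i //= [ss'] jss' Ux Uy.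
have [jj'|/eqP jj'] := eqVneq j j'.
  subst j'; have {}jss' : s <> s' by move=> sE; apply: jss'; rewrite sE.
  have := IH s' j ss' jss' Ux Uy => neq eqf; apply: neq.
  have Xx := compose_word_space j s (U_space Ux).
  have Xy := compose_word_space j s' (U_space Uy).
  have [+ _] := rifs_map_bilipschitz i j Xx Xy.
  rewrite eqf eucl_distxx pmulr_rle0 ?lower_lip_gt0 // => d0.
  have := le_trans (norm_le_eucl_dist _ _) d0.
  by rewrite normr_le0 subr_eq0 => /eqP.
move=> eqf; have : (f i j @` U j `&` f i j' @` U j') (f i j (compose_word j s x)).
  split; first by exists (compose_word j s x) => //; exact: compose_word_open_set.
  by rewrite eqf; exists (compose_word j' s' y) => //; exact: compose_word_open_set.
by rewrite U_disj // => -[].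
Qed.

(** A long code of a point common to [E i] and [U i] has a small piece around
    this point, which is therefore contained in the open set [U i]. *)
Lemma word_into_open_set i : exists s, [/\ s != [::], 0 < prob i s &
  forall x, E (last i s) x -> U i (compose_word i s x)].
Proof.
have [z [Ez Uz]] := EU i.
have /nbhs_ballP [rad rad0 radU] : nbhs z (U i) by apply: open_nbhs_nbhs.
have [q small] := compose_word_contracts rad0.
have [s [sq ps [y Ey zE]]] := limit_set_address q.+1 Ez.
exists s; split => //; first by rewrite -size_eq0 sq.
move=> x Ex; apply: radU; rewrite mx_norm_ball /ball_ /= zE.
apply: le_lt_trans (norm_le_eucl_dist _ _) _; apply: small.
- by rewrite sq.
- exact: limit_set_space Ey.
- exact: limit_set_space Ex.
Qed.

End OpenSets.
End WordMaps.

(** * A strongly separated subsystem *)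

Lemma seq_positive_lower_bound (R : realType) (T : eqType) (L : seq T)
    (Q : T -> R -> Prop) :
  (forall x e e', Q x e -> e' <= e -> Q x e') ->
  (forall x, x \in L -> exists2 e, 0 < e & Q x e) ->
  exists2 e, 0 < e & forall x, x \in L -> Q x e.
Proof.
move=> Qle; elim: L => [|x L IH] LQ; first by exists 1.
have [e e0 eL] := IH (fun y yL => LQ y (mem_behead (s := x :: L) yL)).
have [e' e'0 xe'] := LQ x (mem_head _ _).
exists (Num.min e e'); first by rewrite lt_min e0.
move=> y; rewrite inE => /predU1P[->|yL].
  by apply: Qle xe' _; rewrite ge_min lexx orbT.
by apply: Qle (eL y yL) _; rewrite ge_min lexx.
Qed.

Section WordsOfLength.
Variables (R : realType) (n : nat) (G : 'M[R]_n.+1).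
Hypothesis G_ge0 : forall i j, 0 <= G i j.
Local Notation letter := 'I_n.+1.

Fixpoint positive_words (q : nat) (i : letter) : seq (seq letter) :=
  if q is q'.+1 then
    [seq j :: s | j <- [seq j <- enum 'I_n.+1 | 0 < G i j],
                  s <- positive_words q' j]
  else [:: [::]].

Lemma positive_wordsP q i s : s \in positive_words q i ->
  size s = q /\ 0 < word_prod G i s.
Proof.
elim: q i s => [|q IH] i s /=; first by rewrite inE => /eqP ->.
move=> /allpairsPdep [j [s' [+ s'q ->]]]; rewrite mem_filter => /andP[Gij _].
by have [<- Gs'] := IH _ _ s'q; split => //=; rewrite mulr_gt0.
Qed.

Lemma positive_words_uniq q i : uniq (positive_words q i).
Proof.
elim: q i => [|q IH] i //=.
apply: allpairs_uniq_dep => [||[a b] [a' b'] _ _ /= [-> ->]] //.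
by rewrite filter_uniq // enum_uniq.
Qed.

(** If [v] grows by the factor [th] under one step of the matrix then it grows by
    [th ^+ q] under [q] steps, each path of length [q] being a word. *)
Lemma positive_words_growth (t th : R) (v : letter -> R) q i :
  0 < t -> 0 <= th ->
  (forall i, th * v i <= \sum_j G i j `^ t * v j) ->
  th ^+ q * v i <=
    \sum_(s <- positive_words q i) word_prod G i s `^ t * v (last i s).
Proof.
move=> t0 th0 vG; elim: q i => [|q IH] i /=.
  by rewrite big_seq1 /= powR1 expr0 !mul1r.
rewrite big_allpairs_dep big_filter big_enum_cond /= exprSr -mulrA.
apply: le_trans (_ : th ^+ q * \sum_j G i j `^ t * v j <= _).
  by rewrite ler_wpM2l // exprn_ge0.
rewrite mulr_sumr [leRHS]big_mkcond /=; apply: ler_sum => j _.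
case: ifPn => [Gij|]; last first.
  have := G_ge0 i j; rewrite le_eqVlt => /predU1P[<-|->] // _.
  by rewrite powR0 ?gt_eqF // mul0r mulr0.
rewrite mulrCA; apply: le_trans (ler_wpM2l (powR_ge0 _ _) (IH j)) _.
rewrite mulr_sumr; apply: ler_sum => s _.
by rewrite powRM ?word_prod_ge0 // mulrA.
Qed.

End WordsOfLength.

Lemma weight_word_prod (R : realType) n (P : 'M[R]_n.+1)
    (lip : 'I_n.+1 -> 'I_n.+1 -> R) (r : R) i s :
  (forall i j, 0 < lip i j) ->
  word_prod (weight_mx P lip r) i s =
  word_prod (fun i j => P j i) i s * word_prod lip i s `^ r.
Proof.
move=> lip0; rewrite -word_prod_powR; last by move=> a b; exact: ltW.
rewrite -word_prodM; elim: s i => [|j s IH] i //=.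
by rewrite IH mxE.
Qed.

Section SeparatedSubsystem.
Variables (R : realType) (k n : nat) (I : bilipschitz_rifs R k n).
Variable E : 'I_n.+2 -> set 'rV[R]_k.
Hypothesis limE : limit_sets I E.
Hypothesis sosc : strong_open_set_condition I E.
Local Notation letter := 'I_n.+2.
Variables (r t th : R) (v : letter -> R).
Hypotheses (r_gt0 : 0 < r) (t_gt0 : 0 < t) (th_gt1 : 1 < th).
Hypothesis v_gt0 : forall i, 0 < v i.
Local Notation G := (weight_mx (rifs_mx I) (lower_lip I) r).
Local Notation F := (@compose_word R k n I).
Hypothesis vG : forall i, th * v i <= \sum_j G i j `^ t * v j.

Let G_ge0 i j : 0 <= G i j.
Proof. by apply: weight_ge0; exact: rifs_mx_stochastic. Qed.

Lemma weight_prob_gt0 i s :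
  (0 < word_prod G i s) = (0 < word_prod (transition I) i s).
Proof.
rewrite weight_word_prod; last exact: lower_lip_gt0.
by rewrite pmulr_lgt0 // powR_gt0 // word_prod_gt0 //; exact: lower_lip_gt0.
Qed.

(** The words of length [q] have pieces inside the disjoint sets
    [compose_word i s (U _)] once the words [tau] have been appended. Appending
    them multiplies the weighted sums by at least the constant [e], and [q] is
    chosen such that [e * th ^+ q >= 1]. The pieces are compact, so that
    disjointness already yields a positive distance. *)
Lemma separated_subsystem : exists (W : letter -> seq (seq letter)) (delta : R),
  [/\ 0 < delta, forall i, uniq (W i),
      forall i s, s \in W i -> s != [::] /\ 0 < word_prod G i s,
      forall i, v i <= \sum_(s <- W i) word_prod G i s `^ t * v (last i s) &
      forall i s s', s \in W i -> s' \in W i -> s != s' -> forall x y,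
        E (last i s) x -> E (last i s') y ->
        delta <= eucl_dist (F i s x) (F i s' y)].
Proof.
have [U [U1 U_disj U_image EU]] := sosc.
have U_open i : open (U i) by case: (U1 i).
have U_space i : U i `<=` rifs_space I by case: (U1 i).
have /choice [tau tauP] := word_into_open_set limE U_open EU.
have Gtau j : 0 < word_prod G j (tau j).
  by rewrite weight_prob_gt0; case: (tauP j).
have tau_ratio j : predT j ->
    0 < word_prod G j (tau j) `^ t * v (last j (tau j)) / v j.
  by move=> _; rewrite divr_gt0 ?mulr_gt0 ?powR_gt0.
have [e [e0 e1 eP]] := finite_positive_lower_bound tau_ratio.
have [q qe] : exists q, th^-1 ^+ q <= e.
  apply: exists_exp_le e0.
  rewrite invr_ge0 invf_lt1 ?th_gt1 ?andbT ?(lt_trans ltr01) //.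
  by rewrite ltW // (lt_trans ltr01).
have th0 : 0 < th by rewrite (lt_trans ltr01).
pose W i := [seq s ++ tau (last i s) | s <- positive_words G q i].
have W_pos i s : s \in W i -> s != [::] /\ 0 < word_prod G i s.
  move=> /mapP[u /positive_wordsP [uq Gu] ->].
  have [tau0 ptau _] := tauP (last i u); split.
    by case: (tau _) tau0 => // a b _; case: (u).
  by rewrite word_prod_cat mulr_gt0 // weight_prob_gt0.
have W_neq i s s' : s \in W i -> s' \in W i -> s != s' -> forall x y,
    E (last i s) x -> E (last i s') y -> F i s x <> F i s' y.
  move=> /mapP[u /positive_wordsP [uq Gu] ->].
  move=> /mapP[u' /positive_wordsP [uq' Gu'] ->].
  move=> uu' x y; rewrite !last_cat !compose_word_cat => Ex Ey.
  apply: (compose_word_open_set_neq U_space U_disj U_image).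
  - by rewrite uq uq'.
  - by apply/eqP; apply: contra uu' => /eqP ->.
  - by have [_ _] := tauP (last i u); apply.
  - by have [_ _] := tauP (last i u'); apply.
have sep i : exists2 d, 0 < d & forall ss : seq letter * seq letter,
    ss \in [seq (s, s') | s <- W i, s' <- W i] -> ss.1 != ss.2 -> forall x y,
    E (last i ss.1) x -> E (last i ss.2) y ->
    d <= eucl_dist (F i ss.1 x) (F i ss.2 y).
  apply: (@seq_positive_lower_bound R _ [seq (s, s') | s <- W i, s' <- W i]
    (fun ss d => ss.1 != ss.2 -> forall x y, E (last i ss.1) x ->
      E (last i ss.2) y -> d <= eucl_dist (F i ss.1 x) (F i ss.2 y))).
    move=> ss d d' + d'd neq x y Ex Ey => /(_ neq x y Ex Ey).
    exact: le_trans.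
  move=> ss /allpairsP[[s s'] /= [sW s'W ->]] /=.
  have [->|neq] := eqVneq s s'; first by exists 1.
  have disj : F i s @` E (last i s) `&` F i s' @` E (last i s') = set0.
    rewrite -subset0 => _ [[x Ex <-] [y Ey /esym eqF]].
    exact: (W_neq i s s' sW s'W neq x y Ex Ey eqF).
  have [d d0 dP] := eucl_dist_compact_disjoint
    (@compose_word_compact _ _ _ _ _ limE i s)
    (@compose_word_compact _ _ _ _ _ limE i s') disj.
  by exists d => // _ x y Ex Ey; apply: dP; [exists x | exists y].
pose Q i d := forall ss : seq letter * seq letter,
    ss \in [seq (s, s') | s <- W i, s' <- W i] -> ss.1 != ss.2 -> forall x y,
    E (last i ss.1) x -> E (last i ss.2) y ->
    d <= eucl_dist (F i ss.1 x) (F i ss.2 y).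
have Q_le i d d' : Q i d -> d' <= d -> Q i d'.
  move=> Qd d'd ss ssW neq x y Ex Ey.
  exact: le_trans d'd (Qd ss ssW neq x y Ex Ey).
have [d d0 dP] := @seq_positive_lower_bound R _ (enum letter) Q Q_le
  (fun i _ => sep i).
exists W, d; split => //.
- move=> i; rewrite map_inj_in_uniq ?positive_words_uniq // => s s'.
  move=> /positive_wordsP[sq _] /positive_wordsP[s'q _] /eqP.
  by rewrite eqseq_cat ?sq ?s'q // => /andP[/eqP].
- move=> i; rewrite big_map.
  have growth := positive_words_growth G_ge0 q i t_gt0 (ltW th0) vG.
  apply: le_trans (_ : e * (th ^+ q * v i) <= _).
    rewrite mulrA ler_peMl ?(ltW (v_gt0 i)) //.
    by move: qe; rewrite exprVn -ler_pdivrMr ?exprn_gt0 // div1r.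
  apply: le_trans (ler_wpM2l (ltW e0) growth) _.
  rewrite mulr_sumr; apply: ler_sum => s _.
  rewrite word_prod_cat last_cat powRM ?word_prod_ge0 // mulrCA -mulrA.
  rewrite ler_wpM2l ?powR_ge0 // -ler_pdivlMr //.
  exact: eP.
- move=> i s s' sW s'W neq x y Ex Ey.
  by apply: (dP i _ (s, s')) => //; [rewrite mem_enum | exact: allpairs_f].
Qed.

Let G_lt1 i j : G i j < 1.
Proof.
by apply: weight_lt1 => //; [exact: rifs_mx_stochastic | exact: lower_lip01].
Qed.

(** The tree of the words of the subsystem, cut as in [covering_words]; here one
    letter of the subsystem is a word [a] of [W i] and the estimates go the other
    way. Two words that differ in their first letter have pieces at
    distance at least [delta]; if they share it, the distance obtained for the
    rest is multiplied by at least the lower Lipschitz constant of [a]. *)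
Lemma separated_words : exists K m delta : R,
  [/\ 0 < K, 0 < m, 0 < delta & forall e, 0 < e <= 1 -> forall i,
    exists L : seq (seq letter),
    [/\ uniq L, K * e `^ (- t) <= (size L)%:R,
        forall s, s \in L -> m * e <= word_prod G i s &
        forall s s', s \in L -> s' \in L -> s != s' -> forall x y,
          E (last i s) x -> E (last i s') y ->
          delta * word_prod (lower_lip I) i s <=
            eucl_dist (F i s x) (F i s' y)]].
Proof.
have [W [delta [delta0 W_uniq W_pos W_sum W_sep]]] := separated_subsystem.
have [c [c0 c1 Gc]] := entry_upper_bound G_lt1.
have [m' m'0 m'P] := @seq_positive_lower_bound R _
  [seq (i, s) | i <- enum letter, s <- W i]
  (fun a m => m <= word_prod G a.1 a.2)
  (fun a e e' h h' => le_trans h' h)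
  ltac:(move=> a /allpairsPdep [i [s [_ /W_pos [_ Gs] ->]]];
        exists (word_prod G i s) => //).
pose m := Num.min m' 1.
have m0 : 0 < m by rewrite lt_min m'0 ltr01.
have m1 : m <= 1 by rewrite ge_min lexx orbT.
have mP i s : s \in W i -> m <= word_prod G i s.
  move=> sW; apply: le_trans (_ : m' <= _); first by rewrite ge_min lexx.
  by apply: (m'P (i, s)); apply/allpairsPdep; exists i, s; rewrite mem_enum.
have G_word_le1 i s : word_prod G i s <= 1.
  rewrite -(expr1n _ (size s)); apply: word_prod_le => a b.
  by rewrite G_ge0 ltW.
have W_le i s : s \in W i -> word_prod G i s <= c.
  move=> /W_pos [+ _]; case: s => // j s _ /=.
  by rewrite -[leRHS]mulr1 ler_pM ?word_prod_ge0.
pose V := \sum_i v i.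
have vV i : v i <= V.
  by rewrite /V (bigD1 i) //= lerDl sumr_ge0 // => j _; exact: ltW.
have V0 : 0 < V by exact: lt_le_trans (vV ord0).
have [v_ [v_0 _ v_le]] :=
  @finite_positive_lower_bound R _ predT v (fun i _ => v_gt0 i).
pose good (e : R) i (L : seq (seq letter)) :=
  [/\ uniq L, v i / V * e `^ (- t) <= (size L)%:R,
      forall s, s \in L -> m * e <= word_prod G i s &
      forall s s', s \in L -> s' \in L -> s != s' -> forall x y,
        E (last i s) x -> E (last i s') y ->
        delta * word_prod (lower_lip I) i s <=
          eucl_dist (F i s x) (F i s' y)].
suff claim q : forall e, 0 < e -> c ^+ q <= e -> e <= m^-1 -> forall i,
    exists L, good e i L.
  exists (v_ / V), m, delta; split => //.
    by rewrite divr_gt0.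
  move=> e /andP[e0 e1] i.
  have [q qe] : exists q, c ^+ q <= e by apply: exists_exp_le e0; rewrite c1 ltW.
  have [|L [L1 L2 L3 L4]] := claim q e e0 qe _ i.
    by rewrite (le_trans e1) // invf_ge1.
  exists L; split => //.
  apply: le_trans L2; rewrite ler_wpM2r ?powR_ge0 //.
  by rewrite ler_pM2r ?invr_gt0 // v_le.
have base e i : 1 <= e -> e <= m^-1 -> exists L, good e i L.
  move=> e1 em; have e0 : 0 < e by exact: lt_le_trans e1.
  exists [:: [::]]; split => //=.
  - apply: mulr_ile1; rewrite ?powR_ge0 ?divr_ge0 ?(ltW V0) ?(ltW (v_gt0 i)) //.
      by rewrite ler_pdivrMr // mul1r.
    by rewrite -(powRr0 e) ler_powR // oppr_le0 ltW.
  - by move=> s; rewrite inE => /eqP -> /=; rewrite mulrC -ler_pdivlMr // div1r.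
  - by move=> s s'; rewrite !inE => /eqP -> /eqP ->; rewrite eqxx.
elim: q => [|q IH] e e0 qe em i; (have [e1|e1] := leP 1 e; first exact: base).
  by move: qe; rewrite expr0 leNgt e1.
have /choice [L_ LP] : forall a, exists L : seq (seq letter), a \in W i ->
    good (e / word_prod G i a) (last i a) L.
  move=> a; have [aW|_] := boolP (a \in W i); last by exists [::].
  have [_ Ga] := W_pos i a aW.
  have [|||L LP] := IH (e / word_prod G i a) _ _ _ (last i a).
  - by rewrite divr_gt0.
  - rewrite ler_pdivlMr // (le_trans _ qe) // exprSr.
    by rewrite ler_wpM2l ?W_le // exprn_ge0 // ltW.
  - apply: le_trans (_ : (word_prod G i a)^-1 <= _).
      by rewrite ler_piMl ?invr_ge0 // ltW.
    by rewrite lef_pV2 ?posrE // mP.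
  by exists L.
have E_word a s x : a \in W i -> s \in L_ a -> E (last (last i a) s) x ->
    E (last i a) (F (last i a) s x).
  move=> aW sL Ex; apply: compose_word_limit_set => //.
  have [_ Ga] := W_pos i a aW; have [_ _ L3 _] := LP a aW.
  rewrite -weight_prob_gt0; apply: lt_le_trans (L3 s sL).
  by rewrite mulr_gt0 // divr_gt0.
have lip_le1 j s : 0 <= word_prod (lower_lip I) j s <= 1.
  rewrite word_prod_ge0 /=; last by move=> a b; exact: ltW (lower_lip_gt0 I a b).
  rewrite -(expr1n _ (size s)); apply: word_prod_le => a b.
  by have /andP[c0' /ltW ->] := lower_lip01 I a b; rewrite ltW.
have far a s a' s' : a \in W i -> s \in L_ a -> a' \in W i -> s' \in L_ a' ->
    (a != a') || ((a == a') && (s != s')) -> forall x y,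
    E (last i (a ++ s)) x -> E (last i (a' ++ s')) y ->
    delta * word_prod (lower_lip I) i (a ++ s) <=
      eucl_dist (F i (a ++ s) x) (F i (a' ++ s') y).
  move=> aW sL a'W s'L neq x y; rewrite !last_cat !compose_word_cat => Ex Ey.
  have [aa'|aa'] := eqVneq a a'; last first.
    apply: le_trans (W_sep i a a' aW a'W aa' _ _ (E_word _ _ _ aW sL Ex)
      (E_word _ _ _ a'W s'L Ey)).
    by rewrite ler_piMr ?(ltW delta0) //; case/andP: (lip_le1 i (a ++ s)).
  subst a'; move: neq; rewrite eqxx /= => ss'.
  have [_ _ _ L4] := LP a aW.
  have [+ _] := compose_word_bilipschitz i a
    (limit_set_space limE (E_word _ _ _ aW sL Ex))
    (limit_set_space limE (E_word _ _ _ aW s'L Ey)).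
  apply: le_trans; rewrite word_prod_cat mulrCA ler_wpM2l //.
    by case/andP: (lip_le1 i a).
  exact: (L4 s s' sL s'L ss' x y Ex Ey).
have lip_gt0 j s : 0 < word_prod (lower_lip I) j s.
  by apply: word_prod_gt0; exact: lower_lip_gt0.
exists [seq a ++ s | a <- W i, s <- L_ a]; split.
- apply: allpairs_uniq_dep => [|a aW|]; [exact: W_uniq | by case: (LP a aW) |].
  move=> _ _ /allpairsPdep [a [s [aW sL ->]]] /allpairsPdep [a' [s' [a'W s'L ->]]] /=.
  move=> eq_cat; have [aa'|aa'] := eqVneq a a'.
    subst a'; congr Tagged; apply/eqP.
    by move/eqP: eq_cat; rewrite eqseq_cat // => /andP[_].
  have [[x Ex] _ _ _] := limE (last i (a ++ s)).
  have Ex' := Ex; rewrite eq_cat in Ex'.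
  have := far a s a' s' aW sL a'W s'L _ x x Ex Ex'.
  rewrite aa' -eq_cat eucl_distxx => /(_ isT).
  by rewrite pmulr_rle0 // leNgt lip_gt0.
- rewrite size_allpairs_dep natr_sum_seq.
  apply: le_trans (_ : (\sum_(s <- W i) word_prod G i s `^ t * v (last i s)) / V
    * e `^ (- t) <= _).
    by rewrite ler_wpM2r ?powR_ge0 // ler_pM2r ?invr_gt0.
  rewrite !mulr_suml [leLHS]big_seq [leRHS]big_seq; apply: ler_sum => a aW.
  have [_ Ga] := W_pos i a aW; have [_ L2 _ _] := LP a aW.
  apply: le_trans L2; rewrite powRM ?invr_ge0 ?(ltW e0) ?(ltW Ga) //.
  rewrite -[(word_prod G i a)^-1]powR_inv1 ?(ltW Ga) // -powRrM mulN1r opprK.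
  by rewrite le_eqVlt; apply/orP; left; apply/eqP; ring.
- move=> _ /allpairsPdep [a [s [aW sL ->]]].
  have [_ Ga] := W_pos i a aW; have [_ _ L3 _] := LP a aW.
  have := L3 s sL; rewrite word_prod_cat mulrA ler_pdivrMr //.
  by rewrite [_ * word_prod G i a]mulrC.
- move=> _ _ /allpairsPdep [a [s [aW sL ->]]] /allpairsPdep [a' [s' [a'W s'L ->]]].
  move=> neq; apply: far => //.
  have [aa'|//] := eqVneq a a'; subst a'; rewrite /=.
  by apply: contra neq => /eqP ->.
Qed.

End SeparatedSubsystem.

(** * Measurability of the coding map *)

Section CodeSpaceTopology.
Variables (n : nat).
Implicit Types (w t : words n) (i : 'I_n.+2).

Lemma open_letter_at (l : nat) (i : 'I_n.+2) : open [set t : words n | t l = i].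
Proof.
have cont : continuous (fun t : {ptws nat -> discrete_topology 'I_n.+2} => t l).
  exact: (@proj_continuous nat (fun=> discrete_topology 'I_n.+2) l).
apply: (@open_comp {ptws nat -> discrete_topology 'I_n.+2}
  (discrete_topology 'I_n.+2) (fun t => t l) [set i]).
  by move=> t _; exact: cont.
exact: discrete_open.
Qed.

Lemma open_agreement w (m : nat) :
  open [set t : words n | forall l, (l <= m)%N -> t l = w l].
Proof.
elim: m => [|m IH].
  rewrite (_ : [set t | _] = [set t | t 0%N = w 0%N]); first exact: open_letter_at.
  by apply/seteqP; split => t /= tw; [exact: tw | case].
rewrite (_ : [set t | _] = [set t | forall l, (l <= m)%N -> t l = w l] `&`
  [set t | t m.+1 = w m.+1]); first exact: openI IH (open_letter_at _ _).
apply/seteqP; split => t /=.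
  by move=> tw; split => [l lm|]; apply: tw => //; exact: leqW.
by move=> [tw twm] l; rewrite leq_eqVlt => /predU1P[->//|]; exact: tw.
Qed.

End CodeSpaceTopology.

Lemma open_borel (T : ptopologicalType) (B : set T) :
  open B -> measurable (B : set (borel T)).
Proof. by move=> oB; apply: sub_sigma_algebra. Qed.

Lemma closed_borel (T : ptopologicalType) (B : set T) :
  closed B -> measurable (B : set (borel T)).
Proof.
move=> cB; rewrite -[B]setCK; apply: measurableC.
by apply: open_borel; exact: closed_openC.
Qed.

Section Coding.
Variables (R : realType) (k n : nat) (I : bilipschitz_rifs R k n).
Variable E : 'I_n.+2 -> set 'rV[R]_k.
Hypothesis limE : limit_sets I E.
Variable coding : words n -> 'rV[R]_k.
Hypothesis codingP : coding_map I E coding.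
Local Notation letter := 'I_n.+2.
Local Notation F := (@compose_word R k n I).
Local Notation prob := (word_prod (transition I)).
Implicit Types (t w : words n) (s : seq letter).

Lemma last_mkseq_shift t m : last (t 0) (mkseq (fun l => t l.+1) m) = t m.
Proof. by case: m => // m; rewrite mkseqS last_rcons. Qed.

Lemma word_map_compose t m : word_map I t m = F (t 0) (mkseq (fun l => t l.+1) m).
Proof.
elim: m => [|m IH]; first by apply/funext.
apply/funext => x; rewrite mkseqS -cats1 compose_word_cat last_mkseq_shift /=.
by rewrite IH.
Qed.

Lemma prefix_of_mkseq t i s : prefix_of t i s ->
  t 0 = i /\ mkseq (fun l => t l.+1) (size s) = s.
Proof.
move=> ts; split; first exact: (ts 0%N).
apply: (@eq_from_nth _ ord0); rewrite size_mkseq // => l ls.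
by rewrite nth_mkseq // (ts l.+1).
Qed.

Lemma coding_prefix t i s : code_space I t -> prefix_of t i s ->
  exists2 y, E (last i s) y & coding t = F i s y.
Proof.
move=> Ct ts; have [t0 tE] := prefix_of_mkseq ts.
have tl : t (size s) = last i s by rewrite -t0 -{2}tE last_mkseq_shift.
have : [set coding t] (coding t) by [].
rewrite -codingP //; have [s0|s0] := posnP (size s).
  move/(_ 1%N isT) => [y Ey]; rewrite word_map_compose /= => <-.
  move/size0nil : s0 tl => -> /= tl; exists (rifs_map I (t 0%N) (t 1%N) y) => //.
  rewrite -t0; have [_ _ _ ->] := limE (t 0%N).
  by exists (t 1%N); [exact: (Ct 0%N) | exists y].
by move/(_ (size s) s0) => [y]; rewrite word_map_compose tE t0 tl => Ey <-; exists y.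
Qed.

Lemma code_space_closed : closed (code_space I : set (words n)).
Proof.
rewrite -openC openE /= => t /existsNP [l] /negP Pl.
exists [set t' : words n | t' l = t l /\ t' l.+1 = t l.+1]; first split.
- have -> : [set t' : words n | t' l = t l /\ t' l.+1 = t l.+1] =
    [set t' | t' l = t l] `&` [set t' | t' l.+1 = t l.+1] by [].
  by apply: openI; exact: open_letter_at.
- by [].
- by move=> t' [t'l t'l1] /(_ l); rewrite t'l t'l1; apply/negP.
Qed.

Lemma code_measurable : measurable (code_space I : set (borel (words n))).
Proof. by apply: closed_borel; exact: code_space_closed. Qed.

(** The coding map is continuous on the code space: codes that agree on their
    first letters are mapped into a common small piece. *)
Lemma coding_open_preimage (B : set 'rV[R]_k) : open B ->
  exists2 O : set (words n), open O &
    code_space I `&` coding @^-1` B = code_space I `&` O.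
Proof.
move=> oB.
pose O := \bigcup_(tm in [set tm : words n * nat | code_space I `&`
  [set t | forall l, (l <= tm.2)%N -> t l = tm.1 l] `<=` coding @^-1` B])
  [set t | forall l, (l <= tm.2)%N -> t l = tm.1 l].
exists O.
  by apply: bigcup_open => -[t m] _; exact: open_agreement.
apply/seteqP; split => t [Ct]; last first.
  by move=> [[w m] /= wm tw]; split => //; apply: wm.
move=> Bt; split => //.
have /nbhs_ballP [rad rad0 radB] : nbhs (coding t) B by apply: open_nbhs_nbhs.
have [q small] := compose_word_contracts I rad0.
exists (t, q) => //= t' [Ct' t't].
pose s := mkseq (fun l => t l.+1) q.
have pre (u : words n) : (forall l, (l <= q)%N -> u l = t l) -> prefix_of u (t 0%N) s.
  move=> ut l; rewrite size_mkseq => lq; rewrite ut //.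
  by case: l lq => //= l lq; rewrite nth_mkseq.
have [y Ey yE] := coding_prefix Ct (pre t (fun _ _ => erefl)).
have [y' Ey' y'E] := coding_prefix Ct' (pre t' t't).
apply: radB; rewrite mx_norm_ball /ball_ /= yE y'E.
apply: le_lt_trans (norm_le_eucl_dist _ _) _; apply: small.
- by rewrite size_mkseq.
- exact: limit_set_space limE _ _ Ey.
- exact: limit_set_space limE _ _ Ey'.
Qed.

(** The coding map is only determined on the code space, so a measurable function
    is obtained by making it constant outside. *)
Definition total_coding (x0 : 'rV[R]_k) (t : words n) : 'rV[R]_k :=
  if t \in code_space I then coding t else x0.

Lemma total_coding_measurable x0 :
  measurable_fun setT (total_coding x0 : borel (words n) -> borel 'rV[R]_k).
Proof.
apply: (@measurability _ _ (borel (words n)) (borel 'rV[R]_k) setT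
  (total_coding x0) (@open 'rV[R]_k)) => //.
move=> _ [B oB <-]; rewrite setTI.
have [V oV VE] := coding_open_preimage oB.
have -> : total_coding x0 @^-1` B =
    (code_space I `&` V) `|` (~` code_space I `&` [set t | B x0]).
  rewrite -VE; apply/seteqP; split => t; rewrite /preimage /total_coding /=.
    case: (pselect (code_space I t)) => Ct.
      by rewrite mem_set //; left.
    by rewrite memNset //; right.
  by move=> [[Ct]|[Ct]]; [rewrite mem_set | rewrite memNset].
apply: measurableU; apply: measurableI.
- exact: code_measurable.
- exact: open_borel.
- by apply: measurableC; exact: code_measurable.
- have [Bx|Bx] := pselect (B x0).
    by rewrite (_ : [set t | B x0] = setT) //; apply/seteqP; split.
  by rewrite (_ : [set t | B x0] = set0) //; apply/seteqP; split.
Qed.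

End Coding.

(** * Bounds for the quantization error in terms of words *)

Lemma uniq_injective_card_le (T : eqType) (U : Type) (H : seq T) (A : set U)
    (g : T -> U) (m : nat) :
  uniq H -> (forall s, s \in H -> A (g s)) -> {in H &, injective g} ->
  (A #<= `I_m)%card -> (size H <= m)%N.
Proof.
case: H => [//|s0 H'] ; set H := s0 :: H' => uH gA g_inj Am.
rewrite -card_le_II; apply: card_le_trans Am.
pose h l := g (nth s0 H l).
have h_inj : {in `I_(size H) &, injective h}.
  move=> a b; rewrite !inE /= => aH bH hab; apply/eqP.
  by rewrite -(@nth_uniq _ s0 H a b aH bH uH); apply/eqP/g_inj => //; apply: mem_nth.
have : (h @` `I_(size H) #= `I_(size H))%card by exact: inj_card_eq.
rewrite card_eq_le => /andP[].
move=> _ /card_le_trans; apply; apply: subset_card_le => _ [l lH <-].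
by apply: gA; apply: mem_nth.
Qed.

Section DistanceMeasurable.
Variables (R : realType) (k : nat).

Lemma powR_dist_measurable (A : set 'rV[R]_k) (r : R) : A !=set0 ->
  @measurable_fun _ _ (borel 'rV[R]_k) _ setT
    (fun x => (eucl_dist_set x A `^ r)%:E).
Proof.
move=> A0; apply/measurable_EFinP.
apply: (@measurableT_comp _ _ _ (borel 'rV[R]_k) _ _ (fun y => powR y r)).
  exact: measurable_powR.
apply: (measurability _ (RGenOInfty.measurableE R)) => _ [_ [x ->] <-].
rewrite setTI; apply: open_borel.
apply: open_comp => [y _|]; first exact: eucl_dist_set_continuous.
exact: rray_open.
Qed.

Lemma compact_borel (K : set 'rV[R]_k) :
  compact K -> measurable (K : set (borel 'rV[R]_k)).
Proof.
by move=> cK; apply: closed_borel; exact: compact_closed.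
Qed.

End DistanceMeasurable.

Section QuantizationBounds.
Variables (R : realType) (k n : nat) (I : bilipschitz_rifs R k n).
Variable E : 'I_n.+2 -> set 'rV[R]_k.
Hypothesis limE : limit_sets I E.
Variables (mu : probability (borel 'rV[R]_k) R) (p : 'rV[R]_n.+2).
Variable nu : probability (borel (words n)) R.
Variable coding : words n -> 'rV[R]_k.
Hypotheses (p_stat : stationary I p) (nuP : code_measure I p nu).
Hypothesis codingP : coding_map I E coding.
Hypothesis muE : forall B : set (borel 'rV[R]_k), measurable B ->
  mu B = nu (code_space I `&` coding @^-1` B).
Local Notation letter := 'I_n.+2.
Local Notation F := (@compose_word R k n I).
Local Notation prob := (word_prod (transition I)).
Implicit Types (t w : words n) (s : seq letter).

(** The zeros of a stationary vector are closed under predecessors, so a single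
    zero would make the whole vector vanish. *)
Lemma stationary_gt0 i : 0 < p 0 i.
Proof.
have [p0 p1 pP] := p_stat; have [P0 _] := rifs_mx_stochastic I.
rewrite lt_neqAle p0 andbT eq_sym; apply/negP => /eqP pi0.
suff pj0 j : p 0 j = 0.
  by move: p1; rewrite big1 // => /esym/eqP; rewrite oner_eq0.
apply: (@irreducible_backward_closed _ _ (rifs_mx I) (fun j => p 0 j = 0) P0
  (rifs_mx_irreducible I) _ j i pi0) => a b Pab pb0.
have : (p *m rifs_mx I) 0 b = 0 by rewrite pP.
rewrite mxE => /eqP.
rewrite psumr_eq0 => [/allP/(_ a)|c _]; last by rewrite mulr_ge0.
by rewrite mem_index_enum /= mulf_eq0 (gt_eqF Pab) orbF => /(_ isT)/eqP.
Qed.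

Lemma stationary_le1 i : p 0 i <= 1.
Proof.
have [p0 p1 _] := p_stat; rewrite -p1 (bigD1 i) //= lerDl.
exact: sumr_ge0.
Qed.

Definition word_cylinder i s : set (words n) :=
  cylinder I (fun l => nth ord0 (i :: s) l) (size s).

Lemma word_cylinder_prefix i s t : word_cylinder i s t ->
  code_space I t /\ prefix_of t i s.
Proof. by []. Qed.

Lemma nu_word_cylinder i s : nu (word_cylinder i s) = (prob i s * p 0 (last i s))%:E.
Proof.
have [_ nu_cyl] := nuP; rewrite /word_cylinder nu_cyl; congr (_ * _)%:E; last first.
  by congr (p 0 _); elim: s i => [|j s IH] i //=; rewrite -IH.
elim: s i => [|j s IH] i; first by rewrite big_ord0.
by rewrite big_ord_recl [RHS]/= -IH.
Qed.

Lemma word_cylinder_measurable i s :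
  measurable (word_cylinder i s : set (borel (words n))).
Proof.
apply: (@measurableI _ (borel (words n)) (code_space I)).
  exact: code_measurable.
by apply: open_borel; exact: open_agreement.
Qed.

Lemma code_preimage_measurable (B : set (borel 'rV[R]_k)) : measurable B ->
  measurable (code_space I `&` coding @^-1` B : set (borel (words n))).
Proof.
move=> mB.
have -> : code_space I `&` coding @^-1` B =
    code_space I `&` (total_coding I coding 0) @^-1` B.
  apply/seteqP; split => t [Ct]; rewrite /preimage /total_coding /= mem_set //.
apply: (@measurableI _ (borel (words n))); first exact: code_measurable.
rewrite -[X in measurable X]setTI.
by apply: (total_coding_measurable limE codingP).
Qed.

(** The codes that begin with the word are mapped into its piece; codes that pass
    through another piece may also reach it, hence only an inequality. *)
Lemma mu_word_image i s :
  ((prob i s * p 0 (last i s))%:E <= mu (F i s @` E (last i s)))%E.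
Proof.
have mF : measurable (F i s @` E (last i s) : set (borel 'rV[R]_k)).
  by apply: compact_borel; exact: compose_word_compact.
rewrite muE // -nu_word_cylinder; apply: le_measure; rewrite ?inE.
- exact: word_cylinder_measurable.
- exact: code_preimage_measurable.
move=> t /word_cylinder_prefix [Ct ts]; split => //.
by have [y Ey yE] := coding_prefix limE codingP Ct ts; exists y.
Qed.

Section LowerBound.
Variables (i : letter) (L : seq (seq letter)) (eta : seq letter -> R) (b r : R).
Hypotheses (r_gt0 : 0 < r) (L_uniq : uniq L).
Hypothesis eta_gt0 : forall s, s \in L -> 0 < eta s.
Hypothesis L_separated : forall s s', s \in L -> s' \in L -> s != s' ->
  forall x y, E (last i s) x -> E (last i s') y ->
  eta s + eta s' <= eucl_dist (F i s x) (F i s' y).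
Hypothesis b_le : forall s, s \in L ->
  b <= prob i s * p 0 (last i s) * eta s `^ r.
Hypothesis b_ge0 : 0 <= b.

(** Pigeonhole: by the separation of the pieces a point of [A] is within
    [eta s] of the piece of [s] for at most one [s]. So at least
    [size L - m] pieces stay at distance [eta s] from [A], and each of these
    contributes at least [b] to the integral, as the pieces are disjoint. *)
Lemma quantization_V_ge m :
  ((((size L)%:R - m%:R) * b)%:E <= quantization_V mu m r)%E.
Proof.
apply: le_ereal_inf_tmp => _ [A [A0 Am] <-].
pose hits s a := A a /\ exists2 x, E (last i s) x & eucl_dist (F i s x) a < eta s.
have [a0 Aa0] := A0.
have /choice [g gP] : forall s, exists a, (exists a', hits s a') -> hits s a.
  move=> s; have [[a sa]|no] := pselect (exists a', hits s a'); first by exists a.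
  by exists a0 => /no.
pose H := [seq s <- L | `[< exists a, hits s a >]].
pose N := [seq s <- L | ~~ `[< exists a, hits s a >]].
have sizeH : (size H <= m)%N.
  apply: (uniq_injective_card_le (g := g) _ _ _ Am); first exact: filter_uniq.
    by move=> s; rewrite mem_filter => /andP[/asboolP /gP []].
  move=> s s'; rewrite !mem_filter => /andP[/asboolP /gP [_ [x Ex xg]] sL].
  move=> /andP[/asboolP /gP [_ [y Ey yg]] s'L] gss'; apply/eqP/negPn/negP => ss'.
  have := L_separated sL s'L ss' Ex Ey; rewrite leNgt => /negP; apply.
  apply: le_lt_trans (eucl_dist_triangle (g s) _ _) _.
  by apply: ltrD => //; rewrite eucl_distC gss'.
have sizeN : (size L)%:R - m%:R <= (size N)%:R :> R.
  rewrite lerBlDr -natrD ler_nat -(count_predC (fun s => `[< exists a, hits s a >]) L).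
  by rewrite -!size_filter addnC leq_add2l.
have N_L s : s \in N -> s \in L by rewrite mem_filter => /andP[].
have N_far s x : s \in N -> (F i s @` E (last i s)) x -> eta s <= eucl_dist_set x A.
  rewrite mem_filter => /andP[/asboolP no _] [y Ey <-].
  apply: eucl_dist_set_ge => // a Aa; rewrite leNgt; apply/negP => ya.
  by apply: no; exists a; split => //; exists y.
pose K s : set (borel 'rV[R]_k) := F i s @` E (last i s).
have mK s : measurable (K s) by apply: compact_borel; exact: compose_word_compact.
have eta_ge0 s : 0 <= eta s `^ r by exact: powR_ge0.
apply: le_trans (_ : ((\sum_(s <- N) (eta s `^ r)%:E * mu (K s))%E <= _)%E); last first.
  rewrite (_ : (\sum_(s <- N) (eta s `^ r)%:E * mu (K s) =
    \int[mu]_x \sum_(s <- N) (eta s `^ r * \1_(K s) x)%:E)%E); last first.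
    rewrite ge0_integral_sum //.
    - apply: eq_bigr => s _; rewrite (integralZl_indic _ (fun=> K s)) //.
        by rewrite integral_indic // setIT.
      by move=> /lt_geF; rewrite eta_ge0.
    - move=> s; apply/measurable_EFinP/measurable_funM => //.
    - by move=> s x _; rewrite lee_fin mulr_ge0.
  apply: ge0_le_integral => //.
  - by move=> x _; apply: sume_ge0 => s _; rewrite lee_fin mulr_ge0.
  - apply: emeasurable_sum => s; apply/measurable_EFinP/measurable_funM => //.
  - exact: powR_dist_measurable.
  move=> x _; rewrite sumEFin lee_fin.
  have [[s sN Kx]|noK] := pselect (exists2 s, s \in N & K s x); last first.
    rewrite big_seq big1 ?powR_ge0 // => s sN.
    by rewrite indicE memNset ?mulr0 // => Kx; apply: noK; exists s.
  rewrite (bigD1_seq s) ?filter_uniq //= big_seq_cond.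
  rewrite big1 ?addr0 => [|s' /andP[s'N s's]].
    rewrite indicE mem_set // mulr1; apply: ge0_ler_powR.
    - exact: ltW.
    - by rewrite nnegrE ltW // eta_gt0 // N_L.
    - by rewrite nnegrE eucl_dist_set_ge0.
    - exact: N_far Kx.
  rewrite indicE memNset ?mulr0 // => -[y Ey yx].
  case: Kx => z Ez zx.
  have := L_separated (N_L _ s'N) (N_L _ sN) s's Ey Ez.
  rewrite yx zx eucl_distxx leNgt addr_gt0 //; apply: eta_gt0; exact: N_L.
apply: le_trans (_ : ((\sum_(s <- N) b)%:E <= _)%E).
  rewrite big_const_seq count_predT iter_addr_0 lee_fin -[b *+ _]mulr_natl.
  by rewrite ler_wpM2r.
rewrite -sumEFin big_seq [leRHS]big_seq; apply: lee_sum => s sN.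
apply: le_trans (_ : ((eta s `^ r)%:E * (prob i s * p 0 (last i s))%:E <= _)%E).
  by rewrite -EFinM lee_fin mulrC b_le // N_L.
apply: lee_wpmul2l; first by rewrite lee_fin.
exact: mu_word_image.
Qed.

End LowerBound.

Section UpperBound.
Variables (L : letter -> seq (seq letter)) (D r : R).
Hypothesis r_gt0 : 0 < r.
Hypothesis D_diam : forall x y, rifs_space I x -> rifs_space I y ->
  eucl_dist x y <= D.
Hypothesis L_cover : forall i (t : nat -> letter), t 0 = i ->
  (forall l, 0 < transition I (t l) (t l.+1)) ->
  exists2 s, s \in L i & prefix_of t i s.

(** One point is chosen in the piece of each word. The integral is transported to
    the code space, where each code begins with one of the words, so that the
    integrand is at most the sum of the errors over the cylinders containing the
    code. *)
Lemma quantization_V_le m : (\sum_i size (L i) <= m)%N ->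
  (quantization_V mu m r <=
    (\sum_i \sum_(s <- L i)
      prob i s * p 0 (last i s) * (D * word_prod (upper_lip I) i s) `^ r)%:E)%E.
Proof.
move=> Lm.
have /choice [e eE] : forall i, exists x, E i x by move=> i; have [] := limE i.
pose Q := [seq (i, s) | i <- enum 'I_n.+2, s <- L i].
pose pt (a : letter * seq letter) := F a.1 a.2 (e (last a.1 a.2)).
have sizeQ : size Q = (\sum_i size (L i))%N.
  by rewrite size_allpairs_dep sumnE big_map big_enum.
have memQ i s : s \in L i -> (i, s) \in Q.
  by move=> sL; apply/allpairsPdep; exists i, s; rewrite mem_enum.
pose A : set 'rV[R]_k := pt @` [set` Q].
have coverQ t : code_space I t -> exists2 a, a \in Q & word_cylinder a.1 a.2 t.
  move=> Ct; have [s sL ts] := L_cover (erefl (t 0%N)) Ct.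
  by exists (t 0%N, s); [exact: memQ | split].
have [t0 Ct0] : code_space I !=set0.
  apply/set0P/negP => /eqP C0; have [+ _] := nuP.
  by rewrite C0 measure0 => /esym/eqP; rewrite onee_eq0.
have A0 : A !=set0.
  by have [a aQ _] := coverQ t0 Ct0; exists (pt a), a.
have Am : (A #<= `I_m)%card.
  apply: card_le_trans (card_image_le _ _) _.
  have [a0 _ _] := coverQ t0 Ct0.
  apply: (@card_le_trans _ _ _ (nth a0 Q @` `I_(size Q))).
    apply: subset_card_le => a aQ; exists (index a Q); last exact: nth_index.
    by rewrite /= index_mem.
  apply: card_le_trans (card_image_le _ _) _.
  by rewrite card_le_II sizeQ.
apply: le_trans (_ : (\int[mu]_x (eucl_dist_set x A `^ r)%:E <= _)%E).
  by apply: ereal_inf_lbound; exists A.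
pose phi : borel (words n) -> borel 'rV[R]_k := total_coding I coding 0.
have mphi : measurable_fun setT phi by exact: total_coding_measurable.
pose g (x : borel 'rV[R]_k) : \bar R := (eucl_dist_set x A `^ r)%:E.
have mg : measurable_fun setT g by exact: powR_dist_measurable.
have g0 x : (0 <= g x)%E by rewrite lee_fin powR_ge0.
have mC : measurable (code_space I : set (borel (words n))) by exact: code_measurable.
pose NC : set (borel (words n)) := ~` code_space I.
have mNC : measurable NC by exact: measurableC.
have nuC : nu NC = 0%E.
  by have [C1 _] := nuP; rewrite [LHS]probability_setC // C1 subee.
have -> : (\int[mu]_x g x = \int[nu]_t g (phi t))%E.
  rewrite (_ : \int[nu]_t g (phi t) = \int[pushforward nu phi]_x g x)%E; last first.
    by rewrite (ge0_integral_pushforward mphi).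
  apply: eq_measure_integral => B mB _; apply: (eq_trans (muE mB)).
  have mphiB : measurable (phi @^-1` B).
    by rewrite -[X in measurable X]setTI; exact: mphi.
  have mB' := code_preimage_measurable mB.
  rewrite /pushforward; apply/eqP; rewrite eq_le; apply/andP; split.
    apply: (@le_measure _ _ _ nu); rewrite ?inE //.
    by move=> t [Ct Bt]; rewrite /preimage /= /phi /total_coding mem_set.
  rewrite -[leRHS]adde0 -nuC.
  apply: (@le_trans _ _ (nu ((code_space I `&` coding @^-1` B) `|` NC))).
    apply: (@le_measure _ _ _ nu); rewrite ?inE //.
      exact: measurableU.
    move=> t; rewrite /preimage /= /phi /total_coding.
    have [Ct|Ct] := pselect (code_space I t); last by right.
    by rewrite mem_set //; left.
  exact: measureU2.
pose b a := (D * word_prod (upper_lip I) a.1 a.2) `^ r.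
have b0 a : 0 <= b a by exact: powR_ge0.
(* The value of the integrand outside the code space, a set of measure 0. *)
pose C := eucl_dist_set 0 A `^ r.
have C0 : 0 <= C by exact: powR_ge0.
pose cyl a : set (borel (words n)) := word_cylinder a.1 a.2.
have mcyl a : measurable (cyl a) by exact: word_cylinder_measurable.
have mbc a : measurable_fun setT
    (fun t : borel (words n) => (b a * \1_(cyl a) t)%:E).
  by apply/measurable_EFinP/measurable_funM.
have bc0 a t : (0 <= (b a * \1_(cyl a) t)%:E)%E by rewrite lee_fin mulr_ge0.
have mCc : measurable_fun setT (fun t : borel (words n) => (C * \1_NC t)%:E).
  by apply/measurable_EFinP/measurable_funM.
have sum0 (t : borel (words n)) :
    setT t -> (0 <= \sum_(a <- Q) (b a * \1_(cyl a) t)%:E)%E.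
  by move=> _; apply: sume_ge0.
have msum : measurable_fun setT
    (fun t : borel (words n) => \sum_(a <- Q) (b a * \1_(cyl a) t)%:E)%E.
  exact: emeasurable_sum.
apply: le_trans (_ : (\int[nu]_t (\sum_(a <- Q) (b a * \1_(cyl a) t)%:E +
    (C * \1_NC t)%:E) <= _)%E).
  apply: ge0_le_integral; [exact: measurableT | by move=> t _; exact: g0 | | |].
  - by apply: measurableT_comp mg mphi.
  - exact: emeasurable_funD.
  move=> t _; rewrite /g /phi /total_coding.
  have [Ct|Ct] := pselect (code_space I t); last first.
    rewrite memNset // -[leLHS]add0e leeD //; first exact: sume_ge0.
    by rewrite indicE mem_set // mulr1.
  rewrite mem_set //; have [a aQ at_] := coverQ t Ct.
  apply: lee_paddr; first by rewrite lee_fin mulr_ge0.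
  rewrite (big_rem a aQ) /=; apply: lee_paddr; first exact: sume_ge0.
  rewrite indicE mem_set // mulr1 lee_fin.
  have [_ /(coding_prefix limE codingP Ct) [y Ey ->]] := word_cylinder_prefix at_.
  have le_D : eucl_dist_set (F a.1 a.2 y) A <= D * word_prod (upper_lip I) a.1 a.2.
    apply: le_trans (_ : eucl_dist (F a.1 a.2 y) (pt a) <= _).
      by apply: eucl_dist_set_le; exists a.
    have Xy := limit_set_space limE Ey.
    have Xe := limit_set_space limE (eE (last a.1 a.2)).
    have [_ /le_trans->//] := compose_word_bilipschitz a.1 a.2 Xy Xe.
    rewrite mulrC ler_wpM2r ?D_diam // word_prod_ge0 // => i j.
    exact: ltW (upper_lip_gt0 I i j).
  apply: ge0_ler_powR => //; first exact: ltW.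
    by rewrite nnegrE eucl_dist_set_ge0.
  by rewrite nnegrE (le_trans (eucl_dist_set_ge0 _ _) le_D).
have NC0 (t : borel (words n)) : setT t -> (0 <= (C * \1_NC t)%:E)%E.
  by move=> _; rewrite lee_fin mulr_ge0.
rewrite ge0_integralD //.
rewrite ge0_integral_sum // (integralZl_indic _ (fun=> NC)) //; last first.
  by move=> /lt_geF; rewrite C0.
rewrite integral_indic ?setIT //.
rewrite [X in (_ + _ * X)%E]nuC mule0 adde0.
rewrite big_allpairs_dep big_enum -sumEFin /= lee_sum // => i _.
rewrite -sumEFin lee_sum // => s _.
rewrite (integralZl_indic _ (fun=> cyl (i, s))) //; last first.
  by move=> /lt_geF; rewrite b0.
rewrite integral_indic ?setIT //.
by rewrite [X in (_ * X)%E]nu_word_cylinder -EFinM lee_fin mulrC.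
Qed.

End UpperBound.
End QuantizationBounds.

(** * From error estimates to dimensions *)

Section EventualBounds.
Variable R : realType.

Lemma natr_powR_unbounded (C d : R) : 0 < d ->
  exists M : nat, forall m : nat, (M <= m)%N -> C <= m%:R `^ d.
Proof.
move=> d0; have [C0|C0] := leP C 0.
  by exists 0 => m _; apply: le_trans C0 (powR_ge0 _ _).
exists (Num.truncn (C `^ d^-1)).+1 => m Mm.
have CE : C = (C `^ d^-1) `^ d.
  by rewrite -powRrM mulVf ?gt_eqF // powRr1 // ltW.
rewrite [leLHS]CE; apply: ge0_ler_powR; rewrite ?nnegrE ?powR_ge0 ?ler0n ?ltW //.
by apply: lt_le_trans (truncnS_gt _) _; rewrite ler_nat.
Qed.

Local Open Scope ereal_scope.

Lemma limn_esup_le_eventually (f : nat -> \bar R) (u : R) :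
  (forall u' : R, (u < u')%R -> exists M, forall m, (M <= m)%N -> f m <= u'%:E) ->
  limn_esup f <= u%:E.
Proof.
move=> fu; apply/lee_addgt0Pr => e e0.
have [|M MP] := fu (u + e)%R; first by rewrite ltrDl.
apply: (@le_trans _ _ (ereal_sup (f @` [set m | (M <= m)%N]))).
  by apply: ereal_inf_lbound; exists [set m | (M <= m)%N] => //; exists M.
by apply: ge_ereal_sup => _ [m /= Mm <-]; rewrite -EFinD; exact: MP.
Qed.

Lemma limn_einf_ge_eventually (f : nat -> \bar R) (l : R) :
  (forall l' : R, (l' < l)%R -> exists M, forall m, (M <= m)%N -> l'%:E <= f m) ->
  l%:E <= limn_einf f.
Proof.
move=> fl; rewrite /limn_einf leeNr -EFinN.
apply: limn_esup_le_eventually => u' lu'.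
have [|M MP] := fl (- u')%R; first by rewrite ltrNl.
by exists M => m Mm; rewrite leeNl -EFinN; exact: MP.
Qed.

End EventualBounds.

Section QuantizationRatio.
Variables (R : realType) (k : nat) (mu : probability (borel 'rV[R]_k) R) (r : R).
Hypothesis r_gt0 : 0 < r.

Lemma quantization_V_ge0 m : (0 <= quantization_V mu m r)%E.
Proof.
apply: le_ereal_inf_tmp => _ [A _ <-]; apply: integral_ge0 => x _.
by rewrite lee_fin powR_ge0.
Qed.

Let powR_le_ln (m : nat) (s v : R) : (1 < m)%N -> 0 < s -> 0 < v ->
  (v <= m%:R `^ (- (r / s))) = (r * ln m%:R <= s * - ln v).
Proof.
move=> m1 s0 v0; have m0 : 0 < m%:R :> R by rewrite ltr0n (ltn_trans _ m1).
rewrite -ler_ln ?posrE ?powR_gt0 // ln_powR mulNr lerNr mulrAC.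
by rewrite ler_pdivrMr // [- ln v * _]mulrC.
Qed.

Let ln_nat_gt0 (m : nat) : (1 < m)%N -> 0 < ln (m%:R : R).
Proof. by move=> m1; rewrite ln_gt0 // ltr1n. Qed.

Let quantization_ratioE m (v : R) : (1 < m)%N -> 0 < v ->
  v < 1 -> quantization_V mu m r = v%:E ->
  quantization_ratio mu r m = (r * ln m%:R / (- ln v))%:E.
Proof.
move=> m1 v0 v1 Vv; rewrite /quantization_ratio /quantization_error Vv poweR_EFin.
rewrite !lne_EFin ?powR_gt0 ?ltr0n ?(ltn_trans _ m1) // ln_powR.
have lv : 0 < - ln v by rewrite oppr_gt0 ln_lt0 // v0.
rewrite -EFinN inver -mulrN mulf_eq0 invr_eq0 !gt_eqF //= -EFinM.
by rewrite invfM invrK mulrCA mulrA.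
Qed.

(** The error may vanish; then the denominator of the ratio is infinite and the
    ratio is 0. *)
Lemma quantization_ratio_le (u : R) m : (1 < m)%N -> 0 < u ->
  (quantization_V mu m r <= (m%:R `^ (- (r / u)))%:E)%E ->
  (quantization_ratio mu r m <= u%:E)%E.
Proof.
move=> m1 u0; have := quantization_V_ge0 m.
case VE : (quantization_V mu m r) => [v| |] //; rewrite !lee_fin.
rewrite le_eqVlt => /predU1P[v0 _|v0].
  rewrite /quantization_ratio /quantization_error VE -v0 poweR_EFin.
  rewrite powR0 ?invr_eq0 ?gt_eqF // [X in (_ / - X)%E]le0_lneNy //.
  by rewrite [X in (_ / X)%E]/= invey mule0 lee_fin ltW.
rewrite powR_le_ln // => ule.
have lv : 0 < - ln v.
  by rewrite -(pmulr_rgt0 _ u0) (lt_le_trans _ ule) // mulr_gt0 // ln_nat_gt0.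
have v1 : v < 1.
  by rewrite ltNge; apply/negP => /ln_ge0; rewrite -oppr_le0 leNgt lv.
by rewrite (quantization_ratioE m1 v0 v1 VE) lee_fin ler_pdivrMr.
Qed.

(** The bound by 1 guarantees a positive denominator. *)
Lemma quantization_ratio_ge (l : R) m : (1 < m)%N -> 0 < l ->
  (quantization_V mu m r < 1)%E ->
  ((m%:R `^ (- (r / l)))%:E <= quantization_V mu m r)%E ->
  (l%:E <= quantization_ratio mu r m)%E.
Proof.
move=> m1 l0; have m0 : 0 < m%:R :> R by rewrite ltr0n (ltn_trans _ m1).
case VE : (quantization_V mu m r) => [v| |] //; rewrite lte_fin lee_fin => v1 lv.
have v0 : 0 < v by apply: lt_le_trans lv; exact: powR_gt0.
rewrite (quantization_ratioE m1 v0 v1 VE) lee_fin.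
have ln_v : 0 < - ln v by rewrite oppr_gt0 ln_lt0 // v0.
rewrite ler_pdivlMr //; move: lv.
rewrite -ler_ln ?posrE ?powR_gt0 // ln_powR mulNr lerNl mulrAC.
by rewrite ler_pdivlMr // mulrC.
Qed.

End QuantizationRatio.

Section Dimensions.
Variables (R : realType) (k n : nat) (I : bilipschitz_rifs R k n).
Variable E : 'I_n.+2 -> set 'rV[R]_k.
Variables (mu : probability (borel 'rV[R]_k) R) (r : R).
Hypotheses (limE : limit_sets I E) (sosc : strong_open_set_condition I E).
Hypotheses (muP : associated_measure I E mu) (r_gt0 : 0 < r).
Local Notation Gl := (weight_mx (rifs_mx I) (lower_lip I) r).
Local Notation Gu := (weight_mx (rifs_mx I) (upper_lip I) r).
Local Notation prob := (word_prod (transition I)).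

Lemma lower_radiusE t : lower_radius I r t = spectral_radius (mx_powR Gl t).
Proof. by congr spectral_radius; apply/matrixP => i j; rewrite !mxE. Qed.

Lemma upper_radiusE t : upper_radius I r t = spectral_radius (mx_powR Gu t).
Proof. by congr spectral_radius; apply/matrixP => i j; rewrite !mxE. Qed.

Lemma inv_exponent l : 0 < l -> (l / (r + l))^-1 = 1 + r / l.
Proof. by move=> l0; rewrite invf_div mulrDl divff ?gt_eqF // addrC. Qed.

(** With [m] points the threshold is [e = (a / m) `^ (1 / t)] for
    [t = l / (r + l)]; this is the total error [m * e] of [m] pieces. *)
Lemma powR_scale (a m l : R) : 0 < a -> 0 < m -> 0 < l ->
  m * (a / m) `^ (l / (r + l))^-1 = a * a `^ (r / l) * m `^ (- (r / l)).
Proof.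
move=> a0 m0 l0; have am0 : 0 < a / m by rewrite divr_gt0.
rewrite inv_exponent // powRD ?(gt_eqF am0) ?implybT // powRr1 ?ltW //.
have mV : m^-1 `^ (r / l) = m `^ (- (r / l)).
  by rewrite -powR_inv1 ?ltW // -powRrM mulN1r.
rewrite powRM ?invr_ge0 ?ltW // mV mulrA [m * (a / m)]mulrCA.
by rewrite divff ?gt_eqF // mulr1 mulrA.
Qed.

(** At that threshold the number of words is of order [m / a]. *)
Lemma powR_threshold (a m l : R) : 0 < a -> 0 < m -> 0 < l ->
  ((a / m) `^ (l / (r + l))^-1) `^ (- (l / (r + l))) = m / a.
Proof.
move=> a0 m0 l0.
rewrite -powRrM mulrN mulVf ?powR_inv1 ?invf_div //; first by rewrite ltW // divr_gt0.
by rewrite gt_eqF // divr_gt0 // addr_gt0.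
Qed.

(** The constant [a] is such that the cuts of the trees of all letters at the
    threshold [e] have at most [m] words in total. *)
Lemma quantization_V_upper u : 0 < u -> upper_radius I r (u / (r + u)) = 1 ->
  exists C : R, exists M : nat, forall m : nat, (M <= m)%N ->
    (quantization_V mu m r <= (C * m%:R `^ (- (r / u)))%:E)%E.
Proof.
move=> u0 ru; have [p [nu [coding [p_stat nuP codingP muE]]]] := muP.
set t := u / (r + u) in ru *.
have t0 : 0 < t by rewrite divr_gt0 // addr_gt0.
have G0 := weight_ge0 (upper_lip I) r (rifs_mx_stochastic I).
have G1 := weight_lt1 (rifs_mx_stochastic I) (upper_lip01 I) r_gt0.
have irrG := weight_irreducible r (rifs_mx_stochastic I) (@rifs_mx_irreducible _ _ _ I)
  (upper_lip01 I).
have [_ [v [_ v0 _ vA]]] := perron_frobenius (mx_powR_ge0 Gu t)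
  (mx_powR_irreducible G0 irrG t).
have vG i : \sum_j Gu i j `^ t * v j <= v i.
  rewrite -[leRHS]mul1r -ru upper_radiusE -vA le_eqVlt; apply/orP; left; apply/eqP.
  by apply: eq_bigr => j _; rewrite [mx_powR _ _ _ _]mxE.
have [c [c0 c1 Gc]] := entry_upper_bound G1.
have c01 : 0 < c < 1 by rewrite c0.
have [K K0 KP] := covering_words G0 c01 Gc t0 v0 vG.
have [D D0 XD] := eucl_dist_compact_bounded (@rifs_space_compact _ _ _ I).
pose a := n.+2%:R * K.
have a0 : 0 < a by rewrite mulr_gt0.
exists (D `^ r * (a * a `^ (r / u))), (Num.truncn a).+1 => m am.
have {}am : a <= m%:R.
  by apply: ltW; apply: lt_le_trans (truncnS_gt _) _; rewrite ler_nat.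
have m0 : 0 < m%:R :> R by exact: lt_le_trans am.
pose e := (a / m%:R) `^ t^-1.
have e0 : 0 < e by rewrite powR_gt0 // divr_gt0.
have e1 : e <= 1.
  rewrite -(powRr0 (a / m%:R)); apply: ger_powR; last by rewrite invr_ge0 ltW.
  by rewrite divr_gt0 // ler_pdivrMr // mul1r.
have e01 : 0 < e <= 1 by rewrite e0.
have /choice [L LP] : forall i, exists L, _ := KP e e01.
have sizeL : ((\sum_i size (L i))%N%:R <= m%:R :> R).
  rewrite natr_sum; apply: le_trans (_ : \sum_(i < n.+2) (K * e `^ (- t)) <= _).
    by apply: ler_sum => i _; have [_ + _] := LP i.
  rewrite sumr_const card_ord -[_ *+ n.+2]mulr_natl mulrA -/a powR_threshold // mulrC.
  by rewrite divfK // gt_eqF.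
have bound := quantization_V_le limE nuP codingP muE (L := L) (D := D)
  r_gt0 XD _ (m := m) _.
apply: le_trans (bound _ _) _.
- move=> i x x0 xP; have [cov _ _] := LP i; apply: cov => // l.
  by rewrite weight_gt0; [exact: xP | exact: upper_lip01].
- by rewrite -(ler_nat R).
rewrite lee_fin -mulrA -powR_scale // -/t -/e.
apply: le_trans (_ : \sum_i \sum_(s <- L i) (D `^ r * e) <= _).
  apply: ler_sum => i _; rewrite big_seq [leRHS]big_seq; apply: ler_sum => s sL.
  have [_ _ /(_ s sL)] := LP i; rewrite weight_word_prod; last exact: upper_lip_gt0.
  move=> se; rewrite powRM ?(ltW D0) ?word_prod_ge0 //; last first.
    by move=> ? ?; exact: ltW (upper_lip_gt0 _ _ _).
  rewrite mulrCA; apply: ler_wpM2l; first exact: powR_ge0.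
  apply: le_trans se; rewrite mulrAC ler_piMr //; last exact: stationary_le1 p_stat _.
  by rewrite mulr_ge0 ?powR_ge0 // word_prod_ge0 //; exact: transition_ge0.
under eq_bigr do rewrite big_const_seq count_predT iter_addr_0 -[_ *+ size _]mulr_natl.
rewrite -mulr_suml -natr_sum mulrCA; apply: ler_wpM2l; first exact: powR_ge0.
by rewrite ler_wpM2r ?(ltW e0).
Qed.

(** The eigenvector at the exponent of [l] grows by a factor larger than 1 at the
    smaller exponent of [l'], which is what a separated subsystem requires. One
    starting letter is enough. *)
Lemma quantization_V_lower l l' : 0 < l -> lower_radius I r (l / (r + l)) = 1 ->
  0 < l' -> l' < l ->
  exists2 C : R, 0 < C & exists M : nat, forall m : nat, (M <= m)%N ->
    ((C * m%:R `^ (- (r / l')))%:E <= quantization_V mu m r)%E.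
Proof.
move=> l0 rl l'0 l'l; have [p [nu [coding [p_stat nuP codingP muE]]]] := muP.
have rl0 : 0 < r + l by exact: addr_gt0.
have rl'0 : 0 < r + l' by exact: addr_gt0.
set t := l / (r + l) in rl; set t' := l' / (r + l').
have t0 : 0 < t by rewrite divr_gt0.
have t'0 : 0 < t' by rewrite divr_gt0.
have t't : t' < t.
  rewrite /t' /t ltr_pdivrMr // mulrAC ltr_pdivlMr //.
  have : r * l' < r * l by rewrite ltr_pM2l.
  nra.
have G0 := weight_ge0 (lower_lip I) r (rifs_mx_stochastic I).
have G1 := weight_lt1 (rifs_mx_stochastic I) (lower_lip01 I) r_gt0.
have irrG := weight_irreducible r (rifs_mx_stochastic I) (@rifs_mx_irreducible _ _ _ I)
  (lower_lip01 I).
have [_ [v [_ v0 _ vA]]] := perron_frobenius (mx_powR_ge0 Gl t)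
  (mx_powR_irreducible G0 irrG t).
have [c [c0 c1 Gc]] := entry_upper_bound G1.
have h0 : 0 < t - t' by rewrite subr_gt0.
have ch0 : 0 < c `^ (t - t') by exact: powR_gt0.
have ch1 : c `^ (t - t') < 1.
  have -> : 1 = 1 `^ (t - t') :> R by rewrite powR1.
  by apply: gt0_ltr_powR; rewrite ?nnegrE // ltW.
have th1 : 1 < (c `^ (t - t'))^-1 by rewrite invf_gt1.
have vG i : (c `^ (t - t'))^-1 * v i <= \sum_j Gl i j `^ t' * v j.
  rewrite mulrC ler_pdivrMr // -[leLHS]mul1r -rl lower_radiusE -vA mulr_suml.
  apply: ler_sum => j _; rewrite mulrAC ler_pM2r // [mx_powR _ _ _ _]mxE.
  rewrite -[t in leLHS](subrKC t') powR_entry_add // ?(ltW h0) // mulrC.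
  rewrite ler_wpM2l ?powR_ge0 //.
  by apply: ge0_ler_powR; rewrite ?nnegrE ?Gc ?G0 // ltW.
have [K [g [delta [K0 g0 delta0 sepP]]]] :=
  separated_words limE sosc r_gt0 t'0 th1 v0 vG.
have [q [q0 _ pq]] := @finite_positive_lower_bound R _ predT (fun i => p 0 i)
  (fun i _ => stationary_gt0 p_stat i).
(* With this choice the cut at the threshold [e] has at least [2 * m] words. *)
pose a := K / 2.
have a0 : 0 < a by rewrite divr_gt0.
pose C := q * (delta / 2) `^ r * g.
have C0 : 0 < C by rewrite !mulr_gt0 // powR_gt0 // divr_gt0.
exists (C * (a * a `^ (r / l'))).
  exact: mulr_gt0 C0 (mulr_gt0 a0 (powR_gt0 _ a0)).
exists (Num.truncn a).+1 => m am.
have {}am : a <= m%:R.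
  by apply: ltW; apply: lt_le_trans (truncnS_gt _) _; rewrite ler_nat.
have m0 : 0 < m%:R :> R by exact: lt_le_trans am.
pose e := (a / m%:R) `^ t'^-1.
have e0 : 0 < e by rewrite powR_gt0 // divr_gt0.
have e1 : e <= 1.
  rewrite -(powRr0 (a / m%:R)); apply: ger_powR; last by rewrite invr_ge0 ltW.
  by rewrite divr_gt0 // ler_pdivrMr // mul1r.
have e01 : 0 < e <= 1 by rewrite e0.
have [L [L_uniq sizeL gL sepL]] := sepP e e01 ord0.
have {}sizeL : 2 * m%:R <= (size L)%:R :> R.
  apply: le_trans sizeL; rewrite powR_threshold // le_eqVlt; apply/orP; left; apply/eqP.
  by rewrite /a; field; rewrite gt_eqF.
(* Half of the guaranteed distance, so that the neighbourhoods of radius [eta] of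
   two pieces do not meet. *)
pose eta s := delta / 2 * word_prod (lower_lip I) ord0 s.
have eta0 s : 0 < eta s.
  by rewrite mulr_gt0 ?divr_gt0 ?word_prod_gt0 //; exact: lower_lip_gt0.
have bound := quantization_V_ge limE nuP codingP muE (i := ord0) (L := L) (eta := eta)
  (b := C * e) r_gt0 L_uniq (fun s _ => eta0 s) _ _ _ m.
apply: le_trans (bound _ _ _).
- rewrite lee_fin -mulrA -powR_scale // -/t' -/e mulrCA.
  apply: ler_wpM2r; first by rewrite mulr_ge0 ?(ltW C0) ?(ltW e0).
  by move: sizeL; rewrite mulr_natl mulr2n -lerBrDr.
- move=> s s' sL s'L ss' x y Ex Ey.
  have d1 := sepL s s' sL s'L ss' x y Ex Ey.
  have d2 := sepL s' s s'L sL; rewrite eq_sym ss' in d2.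
  have := d2 isT y x Ey Ex; rewrite eucl_distC /eta.
  lra.
- move=> s sL; have := gL s sL; rewrite weight_word_prod; last exact: lower_lip_gt0.
  have P0 : 0 <= prob ord0 s by apply: word_prod_ge0; exact: transition_ge0.
  have c_ge0 : 0 <= word_prod (lower_lip I) ord0 s `^ r by exact: powR_ge0.
  move=> ge; rewrite /eta powRM ?divr_ge0 ?(ltW delta0) //; last first.
    by apply: word_prod_ge0 => ? ?; exact: ltW (lower_lip_gt0 _ _ _).
  have -> : C * e = q * ((delta / 2) `^ r * (g * e)) by rewrite /C -!mulrA.
  rewrite [leRHS](_ : _ = p 0 (last ord0 s) * ((delta / 2) `^ r *
    (prob ord0 s * word_prod (lower_lip I) ord0 s `^ r))); last by ring.
  apply: ler_pM; [exact: ltW | | exact: (pq (last ord0 s)) | ].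
    by rewrite mulr_ge0 ?powR_ge0 // mulr_ge0 // ltW.
  by apply: ler_wpM2l ge; exact: powR_ge0.
- by rewrite mulr_ge0 ?ltW.
Qed.

(** The constant is absorbed by passing from [l'] to the midpoint of [l'] and
    [l]. *)
Lemma quantization_V_lower_eventually l : 0 < l ->
  lower_radius I r (l / (r + l)) = 1 ->
  forall l', 0 < l' -> l' < l -> exists M : nat, forall m : nat, (M <= m)%N ->
    ((m%:R `^ (- (r / l')))%:E <= quantization_V mu m r)%E.
Proof.
move=> l0 rl l' l'0 l'l.
have [||C C0 [M CM]] := quantization_V_lower l0 rl (l' := (l' + l) / 2); [lra|lra|].
set l'' := (l' + l) / 2 in CM.
have l''0 : 0 < l'' by rewrite /l''; lra.
have d0 : 0 < r / l' - r / l''.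
  by rewrite subr_gt0 ltr_pM2l // ltf_pV2 ?posrE // /l''; lra.
have [M' CM'] := natr_powR_unbounded C^-1 d0.
exists (maxn 1 (maxn M M')) => m; rewrite !geq_max => /and3P[m1 Mm M'm].
have m0 : 0 < m%:R :> R by rewrite ltr0n.
apply: le_trans (CM m Mm); rewrite lee_fin.
rewrite -ler_pdivrMl //.
have -> : m%:R `^ (- (r / l'')) = m%:R `^ (r / l' - r / l'') * m%:R `^ (- (r / l')).
  rewrite -powRD; last by rewrite (gt_eqF m0) implybT.
  by rewrite addrAC subrr add0r.
by apply: ler_wpM2r; [exact: powR_ge0 | exact: CM'].
Qed.

Lemma quantization_V_upper_eventually u : 0 < u ->
  upper_radius I r (u / (r + u)) = 1 ->
  forall u', u < u' -> exists M : nat, forall m : nat, (M <= m)%N ->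
    (quantization_V mu m r <= (m%:R `^ (- (r / u')))%:E)%E.
Proof.
move=> u0 ru u' uu'; have u'0 : 0 < u' by exact: lt_trans uu'.
have [C [M CM]] := quantization_V_upper u0 ru.
have d0 : 0 < r / u - r / u'.
  by rewrite subr_gt0 ltr_pM2l // ltf_pV2.
have [M' CM'] := natr_powR_unbounded C d0.
exists (maxn 1 (maxn M M')) => m; rewrite !geq_max => /and3P[m1 Mm M'm].
have m0 : 0 < m%:R :> R by rewrite ltr0n.
apply: le_trans (CM m Mm) _; rewrite lee_fin.
have -> : m%:R `^ (- (r / u')) = m%:R `^ (r / u - r / u') * m%:R `^ (- (r / u)).
  rewrite -powRD; last by rewrite (gt_eqF m0) implybT.
  by rewrite addrAC subrr add0r.
by apply: ler_wpM2r; [exact: powR_ge0 | exact: CM'].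
Qed.

Lemma upper_quantization_dim_le u : 0 < u ->
  upper_radius I r (u / (r + u)) = 1 ->
  (upper_quantization_dim mu r <= u%:E)%E.
Proof.
move=> u0 ru; apply: limn_esup_le_eventually => u' uu'.
have [M MP] := quantization_V_upper_eventually u0 ru uu'.
exists (maxn 2 M) => m; rewrite geq_max => /andP[m1 Mm].
by apply: quantization_ratio_le => //; [exact: lt_trans uu' | exact: MP].
Qed.

Lemma lower_quantization_dim_ge l u : 0 < l ->
  lower_radius I r (l / (r + l)) = 1 ->
  0 < u -> upper_radius I r (u / (r + u)) = 1 ->
  (l%:E <= lower_quantization_dim mu r)%E.
Proof.
move=> l0 rl u0 ru; apply: limn_einf_ge_eventually => l' l'l.
have [l'' [l''0 l''l l'l'']] : exists l'', [/\ 0 < l'', l'' < l & l' <= l''].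
  exists (Num.max l' (l / 2)).
  by split; rewrite ?lt_max ?gt_max ?le_max ?lexx ?divr_gt0 ?orbT ?l'l //=; lra.
have [M MP] := quantization_V_lower_eventually l0 rl l''0 l''l.
have uu1 : u < u + 1 by rewrite ltrDl.
have u10 : 0 < u + 1 by exact: addr_gt0.
have [M' MP'] := quantization_V_upper_eventually u0 ru uu1.
exists (maxn 2 (maxn M M')) => m; rewrite !geq_max => /and3P[m1 Mm M'm].
apply: (@le_trans _ _ l''%:E); first by rewrite lee_fin.
apply: quantization_ratio_ge => //; last exact: MP.
apply: le_lt_trans (MP' m M'm) _; rewrite lte_fin.
have m1' : 1 < m%:R :> R by rewrite ltr1n.
rewrite powRN invf_lt1 ?powR_gt0 ?(lt_trans ltr01) //.
rewrite -[ltLHS](powRr0 m%:R) /powR gt_eqF ?(lt_trans ltr01) // ltr_expR.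
by rewrite ltr_pM2r ?ln_gt0 // divr_gt0.
Qed.

End Dimensions.

Theorem theorem3p1 (R : realType) (k n : nat) (I : bilipschitz_rifs R k n)
  (E : 'I_n.+2 -> set 'rV[R]_k) (mu : probability (borel 'rV[R]_k) R) (r : R) :
  limit_sets I E ->
  strong_open_set_condition I E ->
  associated_measure I E mu ->
  0 < r ->
  (~~ is_perm_mx (rifs_mx I) ->
     (exists! l : R, 0 < l /\ lower_radius I r (l / (r + l)) = 1) /\
     (exists! u : R, 0 < u /\ upper_radius I r (u / (r + u)) = 1)) /\
  (forall l u : R,
     0 < l -> lower_radius I r (l / (r + l)) = 1 ->
     0 < u -> upper_radius I r (u / (r + u)) = 1 ->
     [/\ (l%:E <= lower_quantization_dim mu r)%E,
         (lower_quantization_dim mu r <= upper_quantization_dim mu r)%E &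
         (upper_quantization_dim mu r <= u%:E)%E]).
Proof.
move=> limE sosc muP r0; split=> [notperm|l u l0 rl u0 ru].
  split.
    have [l [[l0 rl] l_uniq]] := dimension_exponent_unique_exists
      (rifs_mx_stochastic I) (@rifs_mx_irreducible _ _ _ I)
      (lower_lip01 I) r0 notperm.
    exists l; split; first by rewrite lower_radiusE.
    by move=> l'; rewrite lower_radiusE; exact: l_uniq.
  have [u [[u0 ru] u_uniq]] := dimension_exponent_unique_exists
    (rifs_mx_stochastic I) (@rifs_mx_irreducible _ _ _ I)
    (upper_lip01 I) r0 notperm.
  exists u; split; first by rewrite upper_radiusE.
  by move=> u'; rewrite upper_radiusE; exact: u_uniq.
split.
- exact: (lower_quantization_dim_ge limE sosc muP r0 l0 rl u0 ru).
- exact: limn_einf_sup.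
- exact: (upper_quantization_dim_le limE muP r0 u0 ru).
Qed.
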